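(* Let $T$ be a complete first-order theory with monster model $\mathcal{U}$, and suppose $\mu\in\mathfrak{M}_x(\mathcal{U})$ is Borel definable over a small set $A\subset\mathcal{U}$. (a) If $\nu\in\mathfrak{M}_y(\mathcal{U})$ is BD$^{+}$ over $A$, then $\mu\otimes\nu$ is Borel definable over $A$. (b) If $\nu\in\mathfrak{M}_y(\mathcal{U})$ is BD$^{++}$ over $A$, then $((\mu\otimes\nu)\otimes\lambda)|_A=(\mu\otimes(\nu\otimes\lambda))|_A$ for every $\lambda\in\mathfrak{M}_z(\mathcal{U})$.
   Context: $\mathcal{U}$ is a monster model; ''small'' means of cardinality less than its saturation. $\mathfrak{M}_x(B)$ denotes Keisler measures over $B$ in variables $x$ (finitely additive probability measures on $\mathcal{L}_B$-formulas in $x$ modulo $T$), identified with regular Borel probability measures on the Stone space $S_x(B)$; $\mu|_B$ is the restriction to $\mathcal{L}_B$-formulas. $\mu\in\mathfrak{M}_x(\mathcal{U})$ is invariant over $A$ if $\mu(\phi(x,b))=\mu(\phi(x,b'))$ whenever $b\equiv_A b'$; then $F^\phi_{\mu,A}\colon S_y(A)\to[0,1]$, $F^\phi_{\mu,A}(q)=\mu(\phi(x,b))$ for $b\models q$. $\mu$ is Borel definable over $A$ if it is $A$-invariant and every $F^\phi_{\mu,A}$ ($\phi$ an $\mathcal{L}$-formula) is Borel. If $\mu$ is Borel definable over $A$ and $\nu\in\mathfrak{M}_y(\mathcal{U})$, the Morley product $\mu\otimes\nu\in\mathfrak{M}_{xy}(\mathcal{U})$ is given by $(\mu\otimes\nu)(\phi(x,y))=\int_{S_y(B)}F^\phi_{\mu,B}\,d(\nu|_B)$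 for any small $B\supseteq A$ over which $\phi$ is defined (independent of $B$). For $W\subseteq S_{xy}(A)$ and $b\in\mathcal{U}^y$, let $W(x,b)=\{p\in S_x(\mathcal{U}):\operatorname{tp}(a,b/A)\in W$ for some/any $a\models p|_{Ab}\}$; if $W$ is Borel this is a Borel set, and for $A$-invariant $\mu$ one defines $F^W_{\mu,A}(q)=\mu(W(x,b))$ for $b\models q\in S_y(A)$ (well defined). An $A$-invariant $\mu\in\mathfrak{M}_x(\mathcal{U})$ is BD$^{+}$ over $A$ if for every tuple $y$ and every open $U\subseteq S_{xy}(A)$ the map $F^U_{\mu,A}$ is Borel; it is BD$^{++}$ over $A$ if it is BD$^{+}$ over $A$ and for every $y$, every open $U\subseteq S_{xy}(A)$ and every $\nu\in\mathfrak{M}_y(\mathcal{U})$ we have $(\mu\otimes\nu)|_A(U)=\int_{S_y(A)}F^U_{\mu,A}\,d(\nu|_A)$. *)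

(* Defs.v *)
From HB Require Import structures.
From mathcomp Require Import all_boot all_order all_algebra.
From mathcomp Require Import all_classical all_reals all_analysis.
From mathcomp Require Import measurable_realfun.

Set Implicit Arguments.
Unset Strict Implicit.
Unset Printing Implicit Defensive.

Import Order.TTheory GRing.Theory Num.Theory.

Local Open Scope classical_set_scope.
Local Open Scope ring_scope.

Record language := Language {
  funs : Type;
  fun_arity : funs -> nat;
  rels : Type;
  rel_arity : rels -> nat }.

Inductive term (L : language) (V : Type) : Type :=
| TVar of V
| TApp (f : funs L) of ('I_(fun_arity f) -> term L V).

(* The free variables of a formula are named by the elements of V; a quantifier
   binds the variable None of its body. *)
Inductive formula (L : language) (V : Type) : Type :=
| FBot
| FEq of term L V & term L V
| FRel (r : rels L) of ('I_(rel_arity r) -> term L V)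
| FImp of formula L V & formula L V
| FAll of formula L (option V).

Arguments FBot {L V}.

Definition FNeg L (V : Type) (phi : formula L V) := FImp phi FBot.
Definition FTop {L} {V : Type} : formula L V := FNeg FBot.
Definition FOr L (V : Type) (phi psi : formula L V) := FImp (FNeg phi) psi.

Fixpoint term_map L (V W : Type) (g : V -> W) (t : term L V) : term L W :=
  match t with
  | TVar v => TVar L (g v)
  | TApp f ts => TApp (fun i => term_map g (ts i))
  end.

Fixpoint formula_map L (V W : Type) (g : V -> W) (phi : formula L V) : formula L W :=
  match phi with
  | FBot => FBot
  | FEq s t => FEq (term_map g s) (term_map g t)
  | FRel r ts => FRel (fun i => term_map g (ts i))
  | FImp phi1 phi2 => FImp (formula_map g phi1) (formula_map g phi2)
  | FAll phi1 => FAll (formula_map (omap g) phi1)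
  end.

Fixpoint term_fv L (V : Type) (t : term L V) : set V :=
  match t with
  | TVar v => [set v]
  | TApp f ts => [set v | exists i, term_fv (ts i) v]
  end.

Fixpoint fv L (V : Type) (phi : formula L V) : set V :=
  match phi with
  | FBot => set0
  | FEq s t => term_fv s `|` term_fv t
  | FRel r ts => [set v | exists i, term_fv (ts i) v]
  | FImp phi1 phi2 => fv phi1 `|` fv phi2
  | FAll phi1 => [set v | fv phi1 (Some v)]
  end.

Record structure (L : language) := Structure {
  carrier :> pointedType;
  fun_interp : forall f : funs L, ('I_(fun_arity f) -> carrier) -> carrier;
  rel_interp : forall r : rels L, ('I_(rel_arity r) -> carrier) -> Prop }.

Fixpoint eval L (M : structure L) (V : Type) (e : V -> M) (t : term L V) : M :=
  match t with
  | TVar v => e v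
  | TApp f ts => fun_interp (fun i => eval e (ts i))
  end.

Fixpoint sat L (M : structure L) (V : Type) (e : V -> M) (phi : formula L V) : Prop :=
  match phi with
  | FBot => False
  | FEq s t => eval e s = eval e t
  | FRel r ts => rel_interp (fun i => eval e (ts i))
  | FImp phi1 phi2 => sat e phi1 -> sat e phi2
  | FAll phi1 => forall c : M, sat (fun o => oapp e c o) phi1
  end.

Definition theory L := set (formula L void).

Definition satS L (M : structure L) (phi : formula L void) : Prop :=
  sat (fun v : void => match v return M with end) phi.

Definition models L (M : structure L) (T : theory L) : Prop :=
  forall phi, T phi -> satS M phi.

Definition complete_theory L (T : theory L) : Prop :=
  (exists M : structure L, models M T) /\
  (forall phi : formula L void,
     (forall M : structure L, models M T -> satS M phi) \/
     (forall M : structure L, models M T -> satS M (FNeg phi))).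

(* A cardinal is represented by a type of that cardinality. *)
Definition card_lt (S S' : Type) (A : set S) (B : set S') : Prop :=
  card_le A B /\ ~ card_le B A.

Section LU.
Variables (L : language) (U : structure L).
Implicit Types (X Y : Type) (B C : set U).

(* An L_U-formula in the tuple of variables x indexed by X is an L-formula whose
   free variables are either some x_i (inl i) or a parameter u (inr u). An
   L_B-formula is an L_U-formula whose parameters lie in B. *)
Definition params X (phi : formula L (X + U)) : set U :=
  [set u | fv phi (inr u)].

Definition defined_over X B (phi : formula L (X + U)) : Prop := params phi `<=` B.

Definition satU X (a : X -> U) (phi : formula L (X + U)) : Prop :=
  sat (fun v => match v with inl i => a i | inr u => u end) phi.

(* phi(x, y) |-> phi(x, b) *)
Definition inst X Y (phi : formula L ((X + Y) + U)) (b : Y -> U) :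
    formula L (X + U) :=
  formula_map (fun v => match v with
                        | inl (inl i) => inl i
                        | inl (inr j) => inr (b j)
                        | inr u => inr u
                        end) phi.

Definition pair_tuple X Y (a : X -> U) (b : Y -> U) (v : X + Y) : U :=
  match v with inl i => a i | inr j => b j end.

(* b and b' have the same type over A *)
Definition equiv_over Y (A : set U) (b b' : Y -> U) : Prop :=
  forall phi : formula L (Y + U), defined_over A phi -> (satU b phi <-> satU b' phi).

Record stype X B := SType {
  tset : set (formula L (X + U));
  tset_over : forall phi, tset phi -> defined_over B phi;
  tset_complete : forall phi, defined_over B phi -> tset phi \/ tset (FNeg phi);
  tset_finsat : forall n (phi : 'I_n -> formula L (X + U)),
    (forall i, tset (phi i)) -> exists a : X -> U, forall i, satU a (phi i) }.

Definition realizes X B (a : X -> U) (p : stype X B) : Prop :=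
  forall phi, tset p phi -> satU a phi.

Section Tp.
Variables (X : Type) (a : X -> U) (B : set U).

Definition tp_set : set (formula L (X + U)) :=
  [set phi | defined_over B phi /\ satU a phi].

Lemma tp_over phi : tp_set phi -> defined_over B phi.
Proof. by case. Qed.

Lemma tp_complete phi : defined_over B phi -> tp_set phi \/ tp_set (FNeg phi).
Proof.
move=> Bphi; have [aphi|naphi] := EM (satU a phi); first by left.
by right; split=> // u [/Bphi //|[]].
Qed.

Lemma tp_finsat n (phi : 'I_n -> formula L (X + U)) :
  (forall i, tp_set (phi i)) -> exists a0 : X -> U, forall i, satU a0 (phi i).
Proof. by move=> h; exists a => i; have [] := h i. Qed.

Definition tp : stype X B := SType tp_over tp_complete tp_finsat.
End Tp.

Section Restriction.
Variables (X : Type) (p : stype X [set: U]) (C : set U).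

Definition restr_set : set (formula L (X + U)) :=
  [set phi | defined_over C phi /\ tset p phi].

Lemma restr_over phi : restr_set phi -> defined_over C phi.
Proof. by case. Qed.

Lemma restr_complete phi :
  defined_over C phi -> restr_set phi \/ restr_set (FNeg phi).
Proof.
move=> Cphi; have [|pphi|pphi] := @tset_complete _ _ p phi; first by [].
  by left.
by right; split=> // u [/Cphi //|[]].
Qed.

Lemma restr_finsat n (phi : 'I_n -> formula L (X + U)) :
  (forall i, restr_set (phi i)) -> exists a : X -> U, forall i, satU a (phi i).
Proof. by move=> h; apply: (@tset_finsat _ _ p) => i; have [] := h i. Qed.

Definition restr : stype X C := SType restr_over restr_complete restr_finsat.
End Restriction.

Definition cyl X B (phi : formula L (X + U)) : set (stype X B) :=
  [set p | tset p phi].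

End LU.

Arguments cyl {L U X} B phi.
Arguments tp {L U X} a B.

HB.instance Definition _ L (U : structure L) X (B : set U) :=
  gen_eqMixin (stype X B).
HB.instance Definition _ L (U : structure L) X (B : set U) :=
  gen_choiceMixin (stype X B).
HB.instance Definition _ L (U : structure L) X (B : set U) :=
  isPointed.Build (stype X B) (tp (fun=> point) B).
HB.instance Definition _ L (U : structure L) X (B : set U) :=
  isSubBaseTopological.Build (stype X B)
    [set cyl B phi | phi in [set phi | defined_over B phi]] id.

Notation borel_stype X B := (g_sigma_algebraType (@open (stype X B))).

Section Monster.
Variables (L : language) (K : Type) (U : structure L).

Definition small (A : set U) : Prop := card_lt A [set: K].

Definition saturated : Prop :=
  forall (X : finType) (C : set U), small C ->
  forall p : stype X C, exists a : X -> U, realizes a p.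

Definition elementary_on (C : set U) (f : U -> U) : Prop :=
  forall phi : formula L U, fv phi `<=` C -> (sat id phi <-> sat f phi).

Definition automorphism (s : U -> U) : Prop :=
  [/\ bijective s,
      forall (f : funs L) (c : 'I_(fun_arity f) -> U),
        s (fun_interp c) = fun_interp (s \o c) &
      forall (r : rels L) (c : 'I_(rel_arity r) -> U),
        rel_interp c <-> rel_interp (s \o c)].

Definition strongly_homogeneous : Prop :=
  forall (C : set U) (f : U -> U), small C -> elementary_on C f ->
  exists2 s : U -> U, automorphism s & {in C, s =1 f}.

(* The cardinal |K| is larger than the number of L-formulas; in particular it is
   uncountable. *)
Definition monster (T : theory L) : Prop :=
  [/\ models U T, card_lt [set: formula L nat] [set: K],
      saturated & strongly_homogeneous].
End Monster.

Section Keisler.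
Variables (R : realType) (L : language) (U : structure L).
Implicit Types (X Y : finType) (A B : set U).

(* A Keisler measure over B is given by a function on all L_U-formulas of which
   only the values on L_B-formulas matter; thus the restriction to a smaller
   parameter set of a measure given by mu is again given by mu. *)
Definition keisler X B (mu : formula L (X + U) -> R) : Prop :=
  [/\ forall phi, defined_over B phi -> 0 <= mu phi,
      mu FTop = 1,
      forall phi psi, defined_over B phi -> defined_over B psi ->
        (forall a : X -> U, satU a phi <-> satU a psi) -> mu phi = mu psi &
      forall phi psi, defined_over B phi -> defined_over B psi ->
        (forall a : X -> U, ~ (satU a phi /\ satU a psi)) ->
        mu (FOr phi psi) = mu phi + mu psi].

Definition regular_measure X B (m : probability (borel_stype X B) R) : Prop :=
  forall W : set (borel_stype X B), measurable W ->
  forall e : R, 0 < e ->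
  exists C O : set (stype X B),
    [/\ closed C, open O, C `<=` W, W `<=` O & (m (O `\` C) < e%:E)%E].

(* The regular Borel probability measure on the Stone space S_x(B) with which
   (the restriction to B of) a Keisler measure is identified. It exists and is
   unique as soon as keisler B mu holds; the default value is then never used. *)
Definition borel_measure X B (mu : formula L (X + U) -> R) :
    probability (borel_stype X B) R :=
  xget (dirac (point : borel_stype X B) : probability (borel_stype X B) R)
    [set m | regular_measure m /\
             forall phi, defined_over B phi -> m (cyl B phi) = (mu phi)%:E].

Definition invariant_over X A (mu : formula L (X + U) -> R) : Prop :=
  forall Y (phi : formula L ((X + Y) + U)), defined_over set0 phi ->
  forall b b' : Y -> U, equiv_over A b b' -> mu (inst phi b) = mu (inst phi b').

(* F^phi_{mu,B}(q) = mu(phi(x, b)) for b |= q *)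
Definition Ffml X Y B (mu : formula L (X + U) -> R)
    (phi : formula L ((X + Y) + U)) (q : borel_stype Y B) : R :=
  xget 0 [set r | exists2 b : Y -> U, realizes b (q : stype Y B) &
                  r = mu (inst phi b)].

Definition borel_definable X A (mu : formula L (X + U) -> R) : Prop :=
  [/\ keisler [set: U] mu, invariant_over A mu &
      forall Y (phi : formula L ((X + Y) + U)), defined_over set0 phi ->
        measurable_fun [set: borel_stype Y A] (@Ffml X Y A mu phi)].

(* The Morley product, for mu Borel definable over A. The integral may be taken
   over S_y(B) for any small B containing A and the parameters of phi; the least
   such B is used. *)
Definition morley X Y A (mu : formula L (X + U) -> R)
    (nu : formula L (Y + U) -> R) (phi : formula L ((X + Y)%type + U)) : R :=
  \int[borel_measure (A `|` params phi) nu]_q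
     (@Ffml X Y (A `|` params phi) mu phi q).

(* W(x, b) *)
Definition fiber X Y A (W : set (stype (X + Y) A)) (b : Y -> U) :
    set (stype X [set: U]) :=
  [set p | exists2 a : X -> U, realizes a (restr p (A `|` range b)) &
                               W (tp (pair_tuple a b) A)].

(* F^W_{mu,A}(q) = mu(W(x, b)) for b |= q *)
Definition Fset X Y A (mu : formula L (X + U) -> R)
    (W : set (stype (X + Y) A)) (q : borel_stype Y A) : \bar R :=
  xget 0%E [set r | exists2 b : Y -> U, realizes b (q : stype Y A) &
                    r = borel_measure [set: U] mu (fiber W b)].

Definition BDplus X A (mu : formula L (X + U) -> R) : Prop :=
  [/\ keisler [set: U] mu, invariant_over A mu &
      forall Y (O : set (stype (X + Y) A)), open O ->
        measurable_fun [set: borel_stype Y A] (@Fset X Y A mu O)].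

Definition BDplusplus X A (mu : formula L (X + U) -> R) : Prop :=
  BDplus A mu /\
  forall Y (O : set (stype (X + Y)%type A)), open O ->
  forall nu : formula L (Y + U) -> R, keisler [set: U] nu ->
    borel_measure A (morley A mu nu) O =
    (\int[borel_measure A nu]_q (@Fset X Y A mu O q))%E.

(* Equality of restrictions to A, up to the identification of the tuples
   ((x, y), z) and (x, (y, z)). *)
Definition assoc_formula X Y Z (phi : formula L (((X + Y) + Z) + U)) :
    formula L ((X + (Y + Z)) + U) :=
  formula_map (fun v => match v with
                        | inl (inl (inl i)) => inl (inl i)
                        | inl (inl (inr j)) => inl (inr (inl j))
                        | inl (inr k) => inl (inr (inr k))
                        | inr u => inr u
                        end) phi.

Definition eq_restr_assoc X Y Z A
    (w : formula L (((X + Y)%type + Z)%type + U) -> R)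
    (w' : formula L ((X + (Y + Z)%type)%type + U) -> R) : Prop :=
  forall phi : formula L (((X + Y) + Z) + U), defined_over A phi ->
    w phi = w' (assoc_formula phi).

End Keisler.

(* Main.v *)
Require Import Defs.
From HB Require Import structures.
From mathcomp Require Import all_boot all_order all_algebra.
From mathcomp Require Import all_classical all_reals all_analysis.
From mathcomp Require Import measurable_realfun.
From mathcomp Require Import finmap lra giry.

(** The Morley product is rewritten as an integral over a space of types over A
    alone: for c : Z -> U and phi(x, y, z) over A,
      (mu * nu)(phi(x, y, c)) = int over S_yz(A) of F^phi_mu d(nu_c),
    where nu_c(psi(y, z)) = nu(psi(y, c)); this is a change of variables along
    q(y) |-> q(y) c, since regularity makes the Borel measure of a Keisler measure
    natural with respect to continuous substitution maps between Stone spaces.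
    The measure nu_c depends only on tp(c/A), and BD+ says that tp(c/A) |-> nu_c(O)
    is Borel for O open, hence (Dynkin) for all Borel sets, so tp(c/A) |-> nu_c is a
    probability kernel and (a) follows. For (b), BD++ says that the mixture of this
    kernel by lambda agrees on open sets, hence everywhere, with the Borel measure
    of nu * lambda over A; both sides of the associativity identity are then the
    integral of F^phi_mu against this measure. *)

Set Implicit Arguments.
Unset Strict Implicit.
Unset Printing Implicit Defensive.

Import Order.TTheory GRing.Theory Num.Theory.

Local Open Scope classical_set_scope.
Local Open Scope ring_scope.

(** * Formulas and substitutions *)

Section Syntax.
Variable L : language.

Lemma term_map_comp (V W W' : Type) (g : W -> W') (h : V -> W) (t : term L V) :
  term_map g (term_map h t) = term_map (g \o h) t.
Proof. by elim: t => //= f ts IH; congr TApp; apply/funext => i; exact: IH. Qed.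

Lemma formula_map_comp (V W W' : Type) (g : W -> W') (h : V -> W)
    (phi : formula L V) :
  formula_map g (formula_map h phi) = formula_map (g \o h) phi.
Proof.
elim: phi W W' g h => //=.
- by move=> V' s t W W' g h; rewrite !term_map_comp.
- move=> V' r ts W W' g h; congr FRel; apply/funext => i.
  exact: term_map_comp.
- by move=> V' p IHp q IHq W W' g h; rewrite IHp IHq.
- move=> V' p IH W W' g h; rewrite IH; congr (FAll (formula_map _ _)).
  by apply/funext; case.
Qed.

Lemma eq_in_term_map (V W : Type) (g h : V -> W) (t : term L V) :
  (forall v, term_fv t v -> g v = h v) -> term_map g t = term_map h t.
Proof.
elim: t => [v gh|f ts IH gh] /=; first by rewrite gh.
by congr TApp; apply/funext => i; apply: IH => v tv; apply: gh; exists i.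
Qed.

Lemma eq_in_formula_map (V W : Type) (g h : V -> W) (phi : formula L V) :
  (forall v, fv phi v -> g v = h v) -> formula_map g phi = formula_map h phi.
Proof.
elim: phi W g h => //=.
- move=> V' s t W g h gh.
  by congr FEq; apply: eq_in_term_map => v tv; apply: gh; [left|right].
- move=> V' r ts W g h gh; congr FRel; apply/funext => i.
  by apply: eq_in_term_map => v tv; apply: gh; exists i.
- move=> V' p IHp q IHq W g h gh.
  by congr FImp; [apply: IHp|apply: IHq] => v pv; apply: gh; [left|right].
- move=> V' p IH W g h gh; congr FAll; apply: IH => -[v|] //= pv.
  by rewrite gh.
Qed.

Lemma term_map_id (V : Type) (t : term L V) : term_map id t = t.
Proof. by elim: t => //= f ts IH; congr TApp; apply/funext. Qed.

Lemma formula_map_id (V : Type) (phi : formula L V) : formula_map id phi = phi.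
Proof.
elim: phi => //=.
- by move=> V' s t; rewrite !term_map_id.
- by move=> V' r ts; congr FRel; apply/funext => i; rewrite term_map_id.
- by move=> V' p -> q ->.
- move=> V' p IH; rewrite -[in RHS]IH; congr (FAll (formula_map _ _)).
  by apply/funext; case.
Qed.

Lemma term_fv_map (V W : Type) (g : V -> W) (t : term L V) :
  term_fv (term_map g t) = g @` term_fv t.
Proof.
elim: t => [v|f ts IH] /=; first by rewrite image_set1.
apply/seteqP; split=> [w [i]|_ [v [i iv] <-]].
  by rewrite IH => -[v iv <-]; exists v => //; exists i.
by exists i; rewrite IH; exists v.
Qed.

Lemma fv_map (V W : Type) (g : V -> W) (phi : formula L V) :
  fv (formula_map g phi) = g @` fv phi.
Proof.
elim: phi W g => /=.
- by move=> V' W g; rewrite image_set0.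
- by move=> V' s t W g; rewrite !term_fv_map image_setU.
- move=> V' r ts W g.
  apply/seteqP; split=> [w [i]|_ [v [i iv] <-]].
    by rewrite term_fv_map => -[v iv <-]; exists v => //; exists i.
  by exists i; rewrite term_fv_map; exists v.
- by move=> V' p IHp q IHq W g; rewrite IHp IHq image_setU.
- move=> V' p IH W g; apply/seteqP; split=> [w|_ [v pv <-]] /=.
    by rewrite IH => -[[v|]//= pv [<-]]; exists v.
  by rewrite IH; exists (Some v).
Qed.

Lemma finite_ord_bigcup (V : Type) n (F : 'I_n -> set V) :
  (forall i, finite_set (F i)) -> finite_set [set v | exists i, F i v].
Proof.
move=> Ffin; rewrite (_ : [set v | _] = \bigcup_(i in setT) F i).
  by apply: bigcup_finite.
by apply/seteqP; split=> v [i]; exists i.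
Qed.

Lemma finite_term_fv (V : Type) (t : term L V) : finite_set (term_fv t).
Proof.
elim: t => [v|f ts IH] /=; first exact: finite_set1.
exact: finite_ord_bigcup.
Qed.

Lemma finite_fv (V : Type) (phi : formula L V) : finite_set (fv phi).
Proof.
elim: phi => //=.
- by move=> V' s t; rewrite finite_setU; split; exact: finite_term_fv.
- by move=> V' r ts; apply: finite_ord_bigcup => i; exact: finite_term_fv.
- by move=> V' p IHp q IHq; rewrite finite_setU.
- move=> V' p IH; rewrite (_ : [set v | _] = some @^-1` fv p) //.
  by apply: finite_preimage => // x y _ _ [].
Qed.

Lemma eval_term_map (M : structure L) (V W : Type) (g : V -> W) (e : W -> M)
    (t : term L V) :
  Defs.eval e (term_map g t) = Defs.eval (e \o g) t.
Proof.
by elim: t => //= f ts IH; congr fun_interp; apply/funext => i; exact: IH.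
Qed.

Lemma sat_formula_map (M : structure L) (V W : Type) (g : V -> W) (e : W -> M)
    (phi : formula L V) :
  sat e (formula_map g phi) = sat (e \o g) phi.
Proof.
elim: phi W g e => //=.
- by move=> V' s t W g e; rewrite !eval_term_map.
- move=> V' r ts W g e; congr rel_interp; apply/funext => i.
  exact: eval_term_map.
- by move=> V' p IHp q IHq W g e; rewrite IHp IHq.
- move=> V' p IH W g e.
  suff E c : sat (fun o => oapp e c o) (formula_map (omap g) p) =
             sat (fun o => oapp (e \o g) c o) p.
    by apply/propext; split=> H c; have := H c; rewrite E.
  by rewrite IH; congr sat; apply/funext; case.
Qed.
End Syntax.

Section Substitution.
Variables (L : language) (U : structure L).
Implicit Types (B C : set U).

(** A substitution sends each variable to a variable or to a parameter and fixes the parameters.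
    Instantiation, restriction and renaming are all of this form, so one transport lemma for types
    and measures covers them. *)
Definition subst_var (V X : Type) (s : V -> X + U) (v : V + U) : X + U :=
  match v with inl i => s i | inr u => inr u end.

Definition subst (V X : Type) (s : V -> X + U) :
    formula L (V + U) -> formula L (X + U) := formula_map (subst_var s).

Definition subst_tuple (V X : Type) (s : V -> X + U) (a : X -> U) (v : V) : U :=
  match s v with inl i => a i | inr u => u end.

Definition subst_over (V X : Type) (s : V -> X + U) B :=
  forall v u, s v = inr u -> B u.

Definition subst_inst (X Y : Type) (b : Y -> U) (v : X + Y) : X + U :=
  match v with inl i => inl i | inr j => inr (b j) end.

Lemma satU_subst (V X : Type) (s : V -> X + U) (a : X -> U) phi :
  satU a (subst s phi) = satU (subst_tuple s a) phi.
Proof.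
by rewrite /satU sat_formula_map; congr sat; apply/funext => -[].
Qed.

Lemma subst_defined_over (V X : Type) (s : V -> X + U) C B
    (phi : formula L (V + U)) : C `<=` B -> subst_over s B ->
  defined_over C phi -> defined_over B (subst s phi).
Proof.
move=> CB sB Cphi u; rewrite /params/= fv_map => -[[v|w] phiv /=].
  exact: sB.
by move=> [<-]; apply/CB/Cphi.
Qed.

Lemma subst_subst (V W X : Type) (s : W -> X + U) (t : V -> W + U) phi :
  subst s (subst t phi) = subst (subst_var s \o t) phi.
Proof.
by rewrite /subst formula_map_comp; congr formula_map; apply/funext => -[].
Qed.

Lemma inst_subst (X Y : Type) (phi : formula L ((X + Y) + U)) (b : Y -> U) :
  inst phi b = subst (subst_inst b) phi.
Proof. by congr formula_map; apply/funext => -[[]|]. Qed.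

Lemma subst_tuple_inst (X Y : Type) (a : X -> U) (b : Y -> U) :
  subst_tuple (subst_inst b) a = pair_tuple a b.
Proof. by apply/funext => -[]. Qed.

Lemma satU_inst (X Y : Type) (phi : formula L ((X + Y) + U)) a (b : Y -> U) :
  satU a (inst phi b) = satU (pair_tuple a b) phi.
Proof. by rewrite inst_subst satU_subst subst_tuple_inst. Qed.

Lemma subst_inst_over (X Y : Type) (b : Y -> U) B :
  range b `<=` B -> subst_over (@subst_inst X Y b) B.
Proof. by move=> bB [i|j] u //= [<-]; apply: bB; exists j. Qed.

Lemma defined_overS (X : Type) B C (phi : formula L (X + U)) :
  B `<=` C -> defined_over B phi -> defined_over C phi.
Proof. by move=> BC Bphi u /Bphi/BC. Qed.

Lemma inst_defined_over (X Y : Type) (phi : formula L ((X + Y) + U))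
    (b : Y -> U) B :
  defined_over B phi -> range b `<=` B -> defined_over B (inst phi b).
Proof.
move=> Bphi bB; rewrite inst_subst.
apply: subst_defined_over Bphi => //; exact: subst_inst_over.
Qed.

Lemma finite_params (X : Type) (phi : formula L (X + U)) :
  finite_set (params phi).
Proof.
rewrite (_ : params phi = inr @^-1` fv phi) //.
by apply: finite_preimage (finite_fv phi) => x y _ _ [].
Qed.

(** This yields phi(x, y, c) as a formula in the pair (x, y), so that x can still be measured by mu
    and y integrated out. *)
Definition subst_param (X Y Z : Type) (c : Z -> U) (v : X + (Y + Z)) :
    (X + Y) + U :=
  match v with
  | inl i => inl (inl i)
  | inr w => match w with inl j => inl (inr j) | inr k => inr (c k) end
  end.

Lemma subst_param_over (X Y Z : Type) (c : Z -> U) B :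
  range c `<=` B -> subst_over (@subst_param X Y Z c) B.
Proof. by move=> cB [i|[j|k]] u //= [<-]; apply: cB; exists k. Qed.

(** Only finitely many parameters occur, and their finite set D can itself index a tuple of new
    variables, with [val] as the tuple. This reduces claims about formulas with parameters to the
    parameter-free formulas in the definitions of invariance and Borel definability. *)
Lemma extract_params (X Y : Type) (phi : formula L ((X + Y) + U)) :
  exists (Z : finType) (c : Z -> U) (psi : formula L ((X + (Y + Z)) + U)),
    [/\ defined_over set0 psi, range c `<=` params phi &
        phi = subst (subst_param c) psi].
Proof.
have [D phiD] := finite_fsetP.1 (finite_params phi).
exists (D : finType), val.
(* The [None] branch only makes g total: a parameter occurring in phi lies in D. *)
pose g (v : (X + Y) + U) : (X + (Y + D)) + U :=
  match v with
  | inl (inl i) => inl (inl i)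
  | inl (inr j) => inl (inr (inl j))
  | inr u => match insub u with Some k => inl (inr (inr k)) | None => inr u end
  end.
exists (formula_map g phi); split.
- move=> u; rewrite /params/= fv_map => -[[[i|j]|w]] //= phiw.
  case: insubP => // /negP nD _; exfalso; apply: nD.
  by have /= : params phi w by []; rewrite phiD.
- by move=> _ [k _ <-]; rewrite phiD; exact: valP.
- rewrite -[LHS]formula_map_id /subst formula_map_comp.
  apply: eq_in_formula_map => -[[i|j]|w] //= phiw.
  by case: insubP => //= k _ ->.
Qed.
End Substitution.

(** * Small parameter sets are stable under finite extensions *)

Section Small.
Local Open Scope card_scope.
Variables (L : language) (K : Type) (U : structure L).

(* Hilbert's hotel: u takes the place of the first term of a sequence in B. *)
Lemma infinite_setU1_card_le (B : set U) (u : U) :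
  infinite_set B -> B `|` [set u] #<= B.
Proof.
move=> /infiniteP/pcard_leP/injfunPex[f fB finj].
have {}fB n : B (f n) by exact: fB.
have {}finj m n : f m = f n -> m = n by apply: finj; rewrite in_setT.
have [Bu|nBu] := EM (B u); first by rewrite setUidl ?card_lexx// => _ ->.
pose h v := if pselect (v = u) is left _ then f 0%N
  else if pselect (exists n, f n = v) is left H then f (projT1 (cid H)).+1
  else v.
have hu : h u = f 0%N by rewrite /h; case: pselect.
have hB v : B v -> (exists2 n, v = f n & h v = f n.+1) \/
    (h v = v /\ forall n, f n <> v).
  move=> Bv; rewrite /h; case: pselect => [vu|_]; first by subst v.
  case: pselect => [H|nH].
    by left; case: (cid H) => n /= <-; exists n.
  by right; split=> // n fnv; apply: nH; exists n.
apply/pcard_leP/injfunPex; exists h.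
  move=> v [Bv|->]; last by rewrite hu.
  by case: (hB v Bv) => [[n _ ->]|[-> _]].
move=> v w; rewrite !in_setE => -[Bv|->] [Bw|->] //.
- case: (hB _ Bv) => [[n -> ->]|[-> fv]]; case: (hB _ Bw) => [[m -> ->]|[-> fw]].
  + by move=> /finj [->].
  + by move=> /fw.
  + by move=> /esym/fv.
  + by [].
- rewrite hu; case: (hB _ Bv) => [[n -> ->]|[-> fv]]; first by move=> /finj.
  by move=> /esym/fv.
- rewrite hu; case: (hB _ Bw) => [[n -> ->]|[-> fw]]; first by move=> /finj.
  by move=> /fw.
Qed.

Lemma small_setU1 (B : set U) (u : U) :
  [set: nat] #<= [set: K] -> small K B -> small K (B `|` [set u]).
Proof.
(* A finite B stays finite, hence strictly smaller than the infinite K; an infinite B keeps its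
   cardinality. *)
move=> natK [BK nKB]; have [Bfin|Binf] := pselect (finite_set B).
  have Bufin : finite_set (B `|` [set u]) by rewrite finite_setU.
  split; last by move=> /card_le_finite/(_ Bufin); move/infiniteP: natK; apply.
  by apply: card_le_trans natK; exact/finite_set_countable.
have BuB := infinite_setU1_card_le u Binf.
split; first exact: card_le_trans BK.
by move=> KBu; apply: nKB; exact: card_le_trans BuB.
Qed.

Lemma small_setU_finite (B D : set U) :
  [set: nat] #<= [set: K] -> small K B -> finite_set D -> small K (B `|` D).
Proof.
move=> natK Bsmall /finite_fsetP[F ->]; elim/finSet_rect: F => F IH.
have [->|[u uF]] := fset_0Vmem F; first by rewrite set_fset0 setU0.
rewrite -(fsetD1K uF) set_fsetU1 [_ |` _]setUC setUA.
by apply: small_setU1 => //; apply: IH; exact: fproperD1.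
Qed.

(** The formulas v_n = v_n are pairwise distinct. As |K| exceeds the number of formulas, K is
    therefore infinite. *)
Lemma card_le_nat_formula : [set: nat] #<= [set: formula L nat].
Proof.
apply/infiniteP => formfin; pose f (n : nat) := FEq (TVar L n) (TVar L n).
have : finite_set (f @^-1` setT) by apply: finite_preimage => // m n _ _ [].
by rewrite preimage_setT; exact: infinite_nat.
Qed.

End Small.

(** * Stone spaces *)

Section Types.
Variables (L : language) (U : structure L).
Implicit Types (B C : set U) (X Y V : Type).

Definition FAnd V (phi psi : formula L V) := FNeg (FImp phi (FNeg psi)).

Lemma satU_neg X (a : X -> U) phi : satU a (FNeg phi) <-> ~ satU a phi.
Proof. by []. Qed.

Lemma satU_or X (a : X -> U) phi psi :
  satU a (FOr phi psi) <-> satU a phi \/ satU a psi.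
Proof.
rewrite /satU /=; split=> [h|[? n|? _]] //.
by have [|/h] := EM (satU a phi); [left|right].
Qed.

Lemma satU_and X (a : X -> U) phi psi :
  satU a (FAnd phi psi) <-> satU a phi /\ satU a psi.
Proof.
split=> [h|[p q] h]; last exact: h.
by split; apply: contrapT => n; apply: h => p //= /n.
Qed.

Lemma defined_over_neg X B (phi : formula L (X + U)) :
  defined_over B (FNeg phi) <-> defined_over B phi.
Proof. by split=> h u pu; apply: h; [left|case: pu]. Qed.

Lemma defined_over_imp X B (phi psi : formula L (X + U)) :
  defined_over B (FImp phi psi) <-> defined_over B phi /\ defined_over B psi.
Proof.
split=> [h|[hp hq] u [/hp|/hq]] //.
by split=> u pu; apply: h; [left|right].
Qed.

Lemma defined_over_or X B (phi psi : formula L (X + U)) :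
  defined_over B (FOr phi psi) <-> defined_over B phi /\ defined_over B psi.
Proof. by rewrite defined_over_imp defined_over_neg. Qed.

Lemma defined_over_and X B (phi psi : formula L (X + U)) :
  defined_over B (FAnd phi psi) <-> defined_over B phi /\ defined_over B psi.
Proof. by rewrite defined_over_neg defined_over_imp defined_over_neg. Qed.

Lemma defined_over_top X B : defined_over B (FTop : formula L (X + U)).
Proof. by move=> u [[]|[]]. Qed.

Section OneType.
Variables (X : Type) (B : set U) (p : stype X B).

Lemma tset_sat2 phi psi : tset p phi -> tset p psi ->
  exists a : X -> U, satU a phi /\ satU a psi.
Proof.
move=> pphi ppsi.
have [|a ha] := @tset_finsat _ _ _ _ p 2 (fun i => if i == ord0 then phi else psi).
  by move=> i; case: ifP.
by exists a; split; [exact: (ha ord0)|exact: (ha (lift ord0 ord0))].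
Qed.

Lemma tset_negP phi : defined_over B phi -> tset p (FNeg phi) <-> ~ tset p phi.
Proof.
move=> Bphi; split=> [pn pphi|npphi].
  by have [a []] := tset_sat2 pn pphi.
by case: (tset_complete p Bphi).
Qed.

Lemma tset_consequence phi psi : defined_over B psi ->
  (forall a : X -> U, satU a phi -> satU a psi) -> tset p phi -> tset p psi.
Proof.
move=> Bpsi h pphi; apply: contrapT => /(tset_negP Bpsi) pn.
by have [a [/h psia /(_ psia)]] := tset_sat2 pphi pn.
Qed.

Lemma tset_andP phi psi : defined_over B phi -> defined_over B psi ->
  tset p (FAnd phi psi) <-> tset p phi /\ tset p psi.
Proof.
move=> Bphi Bpsi; split=> [pand|[pphi ppsi]].
  by split; apply: tset_consequence pand => // a /satU_and[].
apply: contrapT => pn.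
have {}pn : tset p (FNeg (FAnd phi psi)).
  by apply/tset_negP => //; rewrite defined_over_and.
(* If the conjunction were not in p, then phi, psi and its negation would be three formulas of p
   with no common realization. *)
have [] := @tset_finsat _ _ _ _ p 3
  (fun i => nth FTop [:: phi; psi; FNeg (FAnd phi psi)] i).
  by case=> -[|[|[|]]] //=.
move=> a ha; have := ha (inord 2); have := ha (inord 1); have := ha (inord 0).
by rewrite !inordK //= => h1 h2; apply; exact/satU_and.
Qed.

Lemma tset_top : tset p FTop.
Proof.
have [//|pn] := tset_complete p (@defined_over_top X B).
by have [a [/(_ id)]] := tset_sat2 pn pn.
Qed.

Lemma realizesP (a : X -> U) phi : realizes a p -> defined_over B phi ->
  tset p phi <-> satU a phi.
Proof.
move=> ap Bphi; split; first exact: ap.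
by move=> aphi; apply: contrapT => /(tset_negP Bphi)/ap/(_ aphi).
Qed.

Lemma realizes_equiv (a a' : X -> U) :
  realizes a p -> realizes a' p -> equiv_over B a a'.
Proof. by move=> ap a'p phi Bphi; rewrite -(realizesP ap)// -(realizesP a'p). Qed.

End OneType.

Lemma stype_eq X B (p q : stype X B) :
  (forall phi, defined_over B phi -> tset p phi <-> tset q phi) -> p = q.
Proof.
case: p q => [s so sc sf] [t to tc tf] /= h.
have st : s = t.
  apply/funext => phi; apply/propext; split=> phis.
    by apply/h => //; exact: so.
  by apply/h => //; exact: to.
by subst t; congr SType; exact: Prop_irrelevance.
Qed.

Lemma realizes_tp X B (a : X -> U) : realizes a (tp a B).
Proof. by move=> phi []. Qed.

Lemma realizes_uniq X B (a : X -> U) (p q : stype X B) :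
  realizes a p -> realizes a q -> p = q.
Proof.
by move=> ap aq; apply: stype_eq => phi Bphi;
  rewrite (realizesP ap)// (realizesP aq).
Qed.

Section SubstType.
Variables (X V : Type) (s : V -> X + U) (C B : set U).
Hypotheses (CB : C `<=` B) (sB : subst_over s B).

Section Def.
Variable p : stype X B.

Let subst_set : set (formula L (V + U)) :=
  [set phi | defined_over C phi /\ tset p (subst s phi)].

Let subst_set_over phi : subst_set phi -> defined_over C phi.
Proof. by case. Qed.

Let subst_set_complete phi :
  defined_over C phi -> subst_set phi \/ subst_set (FNeg phi).
Proof.
move=> Cphi; have Cn : defined_over C (FNeg phi) by rewrite defined_over_neg.
have [|?|?] := tset_complete p (phi := subst s phi).
- exact: subst_defined_over Cphi.
- by left.
- by right.
Qed.

Let subst_set_finsat n (phi : 'I_n -> formula L (V + U)) :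
  (forall i, subst_set (phi i)) -> exists a : V -> U, forall i, satU a (phi i).
Proof.
move=> h; have [|a ha] := @tset_finsat _ _ _ _ p n (subst s \o phi).
  by move=> i; have [] := h i.
by exists (subst_tuple s a) => i; rewrite -satU_subst; exact: ha.
Qed.

(** The dual map of a substitution on Stone spaces: the type of s(a) over C for a realizing p. For s
    = [inl] it is restriction to C; for s = [subst_inst c] it is q(y) |-> q(y) c. *)
Definition subst_type : stype V C :=
  SType subst_set_over subst_set_complete subst_set_finsat.
End Def.

Lemma preimage_cyl phi : defined_over C phi ->
  subst_type @^-1` cyl C phi = cyl B (subst s phi).
Proof. by move=> Cphi; apply/seteqP; split=> p //= []. Qed.

Lemma realizes_subst_type (a : X -> U) p :
  realizes a p -> realizes (subst_tuple s a) (subst_type p).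
Proof. by move=> ap phi [_ /ap]; rewrite satU_subst. Qed.

End SubstType.

Section Stone.
Variables (X : Type) (B : set U).
Implicit Type O : set (stype X B).

Lemma cylI (phi psi : formula L (X + U)) : defined_over B phi -> defined_over B psi ->
  cyl B phi `&` cyl B psi = cyl B (FAnd phi psi).
Proof.
move=> Bphi Bpsi; apply/seteqP.
by split=> p /=; rewrite /cyl/= tset_andP.
Qed.

Lemma cylC (phi : formula L (X + U)) : defined_over B phi ->
  ~` cyl B phi = cyl B (FNeg phi).
Proof. by move=> Bphi; apply/seteqP; split=> p /=; rewrite /cyl/= tset_negP. Qed.

Lemma cylU (phi psi : formula L (X + U)) : defined_over B phi -> defined_over B psi ->
  cyl B phi `|` cyl B psi = cyl B (FOr phi psi).
Proof.
move=> Bphi Bpsi.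
apply/seteqP; split=> p /= => [[]|].
- apply: tset_consequence; first by rewrite defined_over_or.
  by move=> a ?; apply/satU_or; left.
- apply: tset_consequence; first by rewrite defined_over_or.
  by move=> a ?; apply/satU_or; right.
- move=> por; apply: contrapT => /not_orP[/(tset_negP p Bphi) np].
  move=> /(tset_negP p Bpsi) nq.
  have : tset p (FAnd (FNeg phi) (FNeg psi)).
    by apply/tset_andP => //; rewrite defined_over_neg.
  by move=> /(tset_sat2 por)[a []] /satU_or + /satU_and[/satU_neg + /satU_neg]; tauto.
Qed.

Lemma cylT : cyl B (FTop : formula L (X + U)) = setT.
Proof. by apply/seteqP; split=> // p _; exact: tset_top. Qed.

Lemma cyl0 : cyl B (FBot : formula L (X + U)) = set0.
Proof. by apply/seteqP; split=> // p /= p0; have [a []] := tset_sat2 p0 p0. Qed.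

Lemma open_cyl (phi : formula L (X + U)) :
  defined_over B phi -> open (cyl B phi : set (stype X B)).
Proof.
move=> Bphi.
exists [set cyl B phi].
  move=> _ ->; exists [fset cyl B phi]%fset.
    by move=> W; rewrite in_fset1 => /eqP ->; apply/mem_set; exists phi.
  by rewrite set_fset1 bigcap_set1.
by rewrite bigcup_set1.
Qed.

(** Cylinders are closed under finite intersections, by conjunction, so the subbase defining the
    topology is already a base. *)
Lemma open_cylP O : open O <->
  forall p, O p -> exists phi, [/\ defined_over B phi, tset p phi & cyl B phi `<=` O].
Proof.
split=> [[D DI <-] p [W DW Wp]|h]; last first.
  pose S := [set phi | defined_over B phi /\ cyl B phi `<=` O].
  rewrite (_ : O = \bigcup_(phi in S) cyl B phi).
    by apply: bigcup_open => phi [Bphi _]; exact: open_cyl.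
  apply/seteqP; split=> p.
    by move=> /h[phi [Bphi pphi sub]]; exists phi.
  by move=> [phi [_ sub]] /sub.
suff [phi [Bphi pphi sub]] :
    exists phi, [/\ defined_over B phi, tset p phi & cyl B phi `<=` W].
  by exists phi; split=> // q /sub Wq; exists W.
have [F FD FW] := DI _ DW; move: Wp; rewrite -FW {DW W FW}.
elim/finSet_rect: F FD => F IH FD Fp.
have [F0|[W WF]] := fset_0Vmem F.
  exists FTop; split; [exact: defined_over_top|exact: tset_top|].
  by move=> q _ W; rewrite /= F0.
have [|V /=||phi [Bphi pphi sub]] := IH (F `\ W)%fset.
- exact: fproperD1.
- by move=> VF; apply: FD; move: VF; rewrite !inE => /andP[].
- by move=> V /=; rewrite !inE => /andP[_ VF]; exact: Fp.
have [psi Bpsi psiW] := set_mem (FD _ WF).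
have ppsi : tset p psi by have := Fp _ WF; rewrite -psiW.
exists (FAnd phi psi); split; first by rewrite defined_over_and.
  by apply/tset_andP.
rewrite -cylI// => q [qphi qpsi] V VF.
have [->|VW] := eqVneq V W; first by rewrite -psiW.
by apply: sub qphi _ _; rewrite /= !inE VW.
Qed.

Lemma closed_cyl (phi : formula L (X + U)) :
  defined_over B phi -> closed (cyl B phi : set (stype X B)).
Proof.
move=> Bphi; rewrite -[cyl B phi]setCK cylC//.
by apply: open_closedC; apply: open_cyl; rewrite defined_over_neg.
Qed.

(** The formulas whose cylinder belongs to F form a type: complete because F is ultra, finitely
    satisfiable because finitely many members of F share a point, which is itself a type. This limit
    yields compactness. *)
Lemma ultrafilter_limit (F : set_system (stype X B)) : UltraFilter F ->
  exists p : stype X B, forall phi, defined_over B phi -> tset p phi <-> F (cyl B phi).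
Proof.
move=> FU; pose S := [set phi | defined_over B phi /\ F (cyl B phi)].
have So phi : S phi -> defined_over B phi by case.
have Sc phi : defined_over B phi -> S phi \/ S (FNeg phi).
  move=> Bphi; have [|] := in_ultra_setVsetC (cyl B phi) FU; first by left.
  by rewrite cylC// => ?; right; split; rewrite ?defined_over_neg.
have Sf n (phi : 'I_n -> formula L (X + U)) :
    (forall i, S (phi i)) -> exists a : X -> U, forall i, satU a (phi i).
  move=> h; have /filter_ex[p hp] : F [set p | forall i, cyl B (phi i) p].
    by apply: filter_forall => i; have [] := h i.
  exact: tset_finsat hp.
by exists (SType So Sc Sf) => phi Bphi; split=> [[]|].
Qed.

Lemma compact_stype : compact [set: stype X B].
Proof.
rewrite compact_ultra => F FU _; have [p hp] := ultrafilter_limit FU.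
exists p; split=> // W; rewrite nbhsE => -[G [/open_cylP Gop Gp] GW].
have [phi [Bphi pphi phiG]] := Gop _ Gp.
by apply: filterS (subset_trans phiG GW) _; apply/hp.
Qed.

Lemma closed_compact (C : set (stype X B)) : closed C -> compact C.
Proof. by move=> Ccl; apply: (subclosed_compact Ccl compact_stype). Qed.

(** C is covered by cylinders inside O; a finite subcover suffices, and its union is a cylinder by
    disjunction. Through this lemma, compact and open sets are compared with values on formulas. *)
Lemma clopen_interpolation (C O : set (stype X B)) :
  compact C -> open O -> C `<=` O ->
  exists phi, [/\ defined_over B phi, C `<=` cyl B phi & cyl B phi `<=` O].
Proof.
move=> + /open_cylP Oop CO; rewrite compact_cover.
pose D := [set W | exists2 phi, defined_over B phi & W = cyl B phi /\ W `<=` O].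
move=> /(_ _ D id).
case.
- by move=> _ [phi Bphi [-> _]]; exact: open_cyl.
- move=> p /CO/Oop[phi [Bphi pphi sub]].
  by exists (cyl B phi) => //; exists phi.
move=> F FD CF.
suff [phi [Bphi phiO phiE]] : exists phi, [/\ defined_over B phi, cyl B phi `<=` O &
    cyl B phi = \bigcup_(W in [set` F]) W].
  by exists phi; split=> //; rewrite phiE.
move=> {CF}; elim/finSet_rect: F FD => F IH FD.
have [F0|[W WF]] := fset_0Vmem F.
  exists FBot; split; rewrite ?cyl0//.
  by apply/seteqP; split=> // q [W /=]; rewrite F0.
have [|V|phi [Bphi phiO phiE]] := IH (F `\ W)%fset; first exact: fproperD1.
  by rewrite !inE => /andP[_ /FD].
have [psi Bpsi [psiW psiO]] := set_mem (FD _ WF).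
exists (FOr psi phi); rewrite -cylU// -psiW phiE -bigcup_setU1.
split; first by rewrite defined_over_or.
  by rewrite bigcup_setU1 -phiE => q [/psiO|/phiO].
by rewrite -set_fsetU1 fsetD1K.
Qed.

End Stone.

Lemma continuous_subst_type (X V : Type) (s : V -> X + U) (C B : set U)
    (CB : C `<=` B) (sB : subst_over s B) : continuous (subst_type CB sB).
Proof.
apply/continuousP => O /open_cylP Oop; apply/open_cylP => p /Oop.
move=> [phi [Cphi [_ pphi] phiO]].
exists (subst s phi); split=> //; first exact: subst_defined_over Cphi.
by rewrite -(preimage_cyl CB sB)//; exact: preimage_subset.
Qed.

End Types.

(** * Regular Borel measures of Keisler measures *)

Lemma probability_sandwich d (T : measurableType d) (R : realType)
    (m : probability T R) (W G G' : set T) (e1 e2 : R) :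
  measurable W -> measurable G -> measurable G' -> W `<=` G -> ~` W `<=` G' ->
  (m G <= m W + e1%:E)%E -> (m G' <= m (~` W) + e2%:E)%E ->
  (m (G `\` ~` G') <= (e1 + e2)%:E)%E.
Proof.
move=> mW mG mG' WG WG'; have G'W : ~` G' `<=` W.
  by move=> p nG'; apply: contrapT => /WG'.
have -> : m (G `\` ~` G') = (m G - (1 - m G'))%E.
  rewrite -probability_setC// [LHS]measureD//.
  - by rewrite setIidr//; exact: subset_trans WG.
  - exact: measurableC.
  - by rewrite ltey_eq fin_num_measure.
rewrite (probability_setC _ mW).
rewrite -(fineK (fin_num_measure m _ mG)) -(fineK (fin_num_measure m _ mG')).
rewrite -(fineK (fin_num_measure m _ mW)) -!EFinB -!EFinD !lee_fin; lra.
Qed.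

Section KeislerTheory.
Variables (R : realType) (L : language) (U : structure L).
Variables (X : finType) (B : set U) (mu : formula L (X + U) -> R).
Hypothesis kmu : keisler B mu.
Implicit Types phi psi : formula L (X + U).

Lemma cyl_subsetP phi psi : defined_over B phi -> defined_over B psi ->
  cyl B phi `<=` cyl B psi <-> forall a : X -> U, satU a phi -> satU a psi.
Proof.
move=> Bphi Bpsi; split=> [sub a aphi|h p]; last exact: tset_consequence.
by have /sub[] : cyl B phi (tp a B) by [].
Qed.

Lemma keisler_ge0 phi : defined_over B phi -> 0 <= mu phi.
Proof. by case: kmu => + _ _ _; exact. Qed.

Lemma keislerT : mu FTop = 1.
Proof. by case: kmu. Qed.

Lemma keisler_eq phi psi : defined_over B phi -> defined_over B psi ->
  (forall a : X -> U, satU a phi <-> satU a psi) -> mu phi = mu psi.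
Proof. by case: kmu => _ _ + _; exact. Qed.

Lemma keislerU phi psi : defined_over B phi -> defined_over B psi ->
  (forall a : X -> U, ~ (satU a phi /\ satU a psi)) ->
  mu (FOr phi psi) = mu phi + mu psi.
Proof. by case: kmu => _ _ _; exact. Qed.

Lemma keisler_split phi psi : defined_over B phi -> defined_over B psi ->
  mu phi = mu (FAnd phi psi) + mu (FAnd phi (FNeg psi)).
Proof.
move=> Bphi Bpsi; have Bn : defined_over B (FNeg psi) by rewrite defined_over_neg.
rewrite -keislerU ?defined_over_and//; last first.
  by move=> a [/satU_and[_ apsi] /satU_and[_ /(_ apsi)]].
apply: keisler_eq => //; first by rewrite defined_over_or !defined_over_and.
move=> a; rewrite satU_or !satU_and satU_neg.
by have := EM (satU a psi); tauto.
Qed.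

Lemma keisler_le phi psi : defined_over B phi -> defined_over B psi ->
  cyl B phi `<=` cyl B psi -> mu phi <= mu psi.
Proof.
move=> Bphi Bpsi /cyl_subsetP - /(_ Bphi Bpsi) sub.
have Bn : defined_over B (FNeg phi) by rewrite defined_over_neg.
rewrite (keisler_split Bpsi Bphi) [X in _ <= X + _](_ : _ = mu phi).
  by rewrite lerDl keisler_ge0// defined_over_and.
apply: keisler_eq => //; first by rewrite defined_over_and.
by move=> a; rewrite satU_and; split=> [[]//|aphi]; split=> //; exact: sub.
Qed.

Lemma keisler_leU phi psi1 psi2 : defined_over B phi -> defined_over B psi1 ->
  defined_over B psi2 -> cyl B phi `<=` cyl B psi1 `|` cyl B psi2 ->
  mu phi <= mu psi1 + mu psi2.
Proof.
move=> Bphi B1 B2; rewrite cylU// => sub.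
have Bn : defined_over B (FNeg psi1) by rewrite defined_over_neg.
have BU : defined_over B (FOr psi1 psi2) by rewrite defined_over_or.
rewrite (keisler_split Bphi B1); apply: lerD; apply: keisler_le => //.
- by rewrite defined_over_and.
- by rewrite -cylI// => p [].
- by rewrite defined_over_and.
- by rewrite -cylI// -cylC// => p [/sub]; rewrite -cylU// => -[].
Qed.

Lemma keisler0 : mu FBot = 0.
Proof.
have B0 : defined_over B (FBot : formula L (X + U)) by [].
have : mu (FOr FBot FBot) = mu FBot by apply: keisler_eq => //;
    [move=> u [[]|]|move=> a; split=> [/(_ id)|]].
rewrite keislerU//; last by move=> a [].
by move=> /eqP; rewrite -subr_eq0 addrK => /eqP.
Qed.

Lemma keisler_le1 phi : defined_over B phi -> mu phi <= 1.
Proof.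
move=> Bphi; rewrite -keislerT; apply: keisler_le => //.
  exact: defined_over_top.
by rewrite cylT.
Qed.

Local Open Scope ereal_scope.

(* The Borel sets of a Stone space need not be generated by the cylinders, so
   extending mu as a measure on the algebra of cylinders is not enough: the outer
   measure is built from open sets, whose Caratheodory measurability uses
   compactness. *)
Let inner (O : set (stype X B)) : \bar R := ereal_sup
  [set (mu phi)%:E | phi in [set phi | defined_over B phi /\ cyl B phi `<=` O]].

Let outer (E : set (stype X B)) : \bar R := ereal_inf
  [set inner O | O in [set O | open O /\ E `<=` O]].

Let inner_ub O phi : defined_over B phi -> cyl B phi `<=` O ->
  (mu phi)%:E <= inner O.
Proof. by move=> Bphi sub; apply: ereal_sup_ubound; exists phi. Qed.

Let inner_lub O x :
  (forall phi, defined_over B phi -> cyl B phi `<=` O -> (mu phi)%:E <= x) ->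
  inner O <= x.
Proof. by move=> h; apply: ge_ereal_sup => _ [phi [Bphi sub] <-]; exact: h. Qed.

Let inner_ge0 O : 0 <= inner O.
Proof.
have -> : 0 = (mu FBot)%:E by rewrite keisler0.
by apply: inner_ub; rewrite ?cyl0.
Qed.

Let inner_mono O O' : O `<=` O' -> inner O <= inner O'.
Proof.
move=> OO'; apply: inner_lub => phi Bphi sub; apply: inner_ub => //.
exact: subset_trans OO'.
Qed.

Let inner_cyl phi : defined_over B phi -> inner (cyl B phi) = (mu phi)%:E.
Proof.
move=> Bphi; apply/eqP; rewrite eq_le inner_ub// andbT.
by apply: inner_lub => psi Bpsi sub; rewrite lee_fin keisler_le.
Qed.

Let inner_lt_pinfty O : inner O < +oo.
Proof.
apply: (@le_lt_trans _ _ 1); last exact: ltry.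
by apply: inner_lub => phi Bphi _; rewrite lee_fin keisler_le1.
Qed.

(** A formula below [O \ cyl B phi] is inconsistent with phi, so their disjunction lies below O and
    has the sum of the values. *)
Let inner_setD O phi : defined_over B phi -> cyl B phi `<=` O ->
  inner (O `\` cyl B phi) + (mu phi)%:E <= inner O.
Proof.
move=> Bphi sub; rewrite -leeBrDr//; apply: inner_lub => psi Bpsi psiO.
rewrite leeBrDr// -EFinD -keislerU//.
  apply: inner_ub; rewrite ?defined_over_or// -cylU//.
  by move=> p [/psiO[]|/sub].
move=> a [apsi aphi]; have : cyl B psi (tp a B) by [].
by move=> /psiO[_]; apply.
Qed.

(** For phi below the union, the part of its cylinder outside O is compact and contained in O', so a
    formula psi separates it there. Then phi is covered by [FAnd phi (FNeg psi)], below O, and psi,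
    below O'. *)
Let innerU O O' : open O -> open O' -> inner (O `|` O') <= inner O + inner O'.
Proof.
move=> oO oO'; apply: inner_lub => phi Bphi sub.
have [|||psi [Bpsi psi1 psiO']] :=
    @clopen_interpolation _ _ _ _ (cyl B phi `&` ~` O) O'.
- apply: closed_compact.
  by apply: closedI; [exact: closed_cyl|exact: open_closedC].
- exact: oO'.
- by move=> p [/sub[]].
have Bn : defined_over B (FNeg psi) by rewrite defined_over_neg.
have Band : defined_over B (FAnd phi (FNeg psi)) by rewrite defined_over_and.
apply: (@le_trans _ _ ((mu (FAnd phi (FNeg psi)))%:E + (mu psi)%:E)).
  rewrite -EFinD lee_fin; apply: keisler_leU => //.
  rewrite -cylI// -cylC// => p pphi.
  by have [|] := EM (cyl B psi p); [right|left].
apply: leeD; apply: inner_ub => //; rewrite -cylI// -cylC// => p [pphi npsi].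
by apply: contrapT => nO; apply: npsi; exact: psi1.
Qed.

Let inner_bigcup (O : (set (stype X B))^nat) : (forall n, open (O n)) ->
  inner (\bigcup_n O n) <= \sum_(n <oo) inner (O n).
Proof.
move=> oO; apply: inner_lub => phi Bphi sub.
have := closed_compact (closed_cyl Bphi); rewrite compact_cover.
move=> /(_ nat setT O (fun n _ => oO n) sub)[F _ phiF].
(* By compactness the cylinder of phi is already covered by the sets with index below N, which
   reduces the claim to finite unions. *)
pose N := (\max_(i <- F) i).+1.
have {phiF} phiN : cyl B phi `<=` \big[setU/set0]_(i < N) O i.
  move=> p /phiF[n /= nF On]; rewrite -bigcup_mkord; exists n => //=.
  by rewrite ltnS; exact: leq_bigmax_seq.
apply: (@le_trans _ _ (\sum_(0 <= i < N) inner (O i))); last first.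
  by apply: nneseries_lim_ge => n _ _; exact: inner_ge0.
apply: (@le_trans _ _ (inner (\big[setU/set0]_(i < N) O i))).
  exact: inner_ub.
elim: N {phiN} => [|N IH].
  rewrite big_ord0 big_geq// -cyl0 inner_cyl// keisler0//.
rewrite big_ord_recr big_nat_recr//=; apply: le_trans (leeD IH (lexx _)).
by apply: innerU => //; rewrite -bigcup_mkord; exact: bigcup_open.
Qed.

Let outer_ub E O : open O -> E `<=` O -> outer E <= inner O.
Proof. by move=> oO EO; apply: ereal_inf_lbound; exists O. Qed.

Let outer_glb E x : (forall O, open O -> E `<=` O -> x <= inner O) -> x <= outer E.
Proof. by move=> h; apply: le_ereal_inf_tmp => _ [G [oG EG] <-]; exact: h. Qed.

Let outer_open O : open O -> outer O = inner O.
Proof.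
move=> oO; apply/eqP; rewrite eq_le outer_ub//=.
by apply: outer_glb => O' _ /inner_mono.
Qed.

Let outer_ge0 E : 0 <= outer E.
Proof. by apply: outer_glb. Qed.

Let outer_mono : {homo outer : E F / E `<=` F >-> E <= F}.
Proof.
move=> E F EF; apply: outer_glb => O oO FO.
by apply: outer_ub => //; exact: subset_trans FO.
Qed.

Let outer_cyl phi : defined_over B phi -> outer (cyl B phi) = (mu phi)%:E.
Proof. by move=> Bphi; rewrite outer_open ?inner_cyl//; exact: open_cyl. Qed.

Let outer0 : outer set0 = 0.
Proof. by rewrite -cyl0 outer_cyl// keisler0. Qed.

Let outer_fin E : outer E \is a fin_num.
Proof.
rewrite ge0_fin_numE//; apply: le_lt_trans (inner_lt_pinfty setT).
by apply: outer_ub; first exact: openT.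
Qed.

Let outer_approx E (e : R) : (0 < e)%R ->
  exists O, [/\ open O, E `<=` O & inner O <= outer E + e%:E].
Proof.
move=> e0; have [_ [G [oG EG] <-] lt] := lb_ereal_inf_adherent e0 (outer_fin E).
by exists G; split=> //; exact: ltW.
Qed.

Let outer_sigma_subadditive : sigma_subadditive outer.
Proof.
move=> E; apply/lee_addgt0Pr => e e0.
(* The n-th set is approximated up to e / 2^(n+1), so that the errors add up to at most e. *)
have en0 n : (0 < e / (2 ^ n.+1)%:R)%R.
  by rewrite divr_gt0// ltr0n expn_gt0.
pose O n := projT1 (cid (outer_approx (E n) (en0 n))).
have OE n : [/\ open (O n), E n `<=` O n &
    inner (O n) <= outer (E n) + (e / (2 ^ n.+1)%:R)%:E].
  by rewrite /O; case: cid.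
apply: (@le_trans _ _ (inner (\bigcup_n O n))).
  apply: outer_ub.
    by apply: bigcup_open => n _; case: (OE n).
  by apply: subset_bigcup => n _; case: (OE n).
apply: (@le_trans _ _ (\sum_(n <oo) inner (O n))).
  by apply: inner_bigcup => n; case: (OE n).
apply: le_trans (epsilon_trick xpredT _ (ltW e0)) => //.
by apply: lee_nneseries => [n _ _|n _]; [exact: inner_ge0|case: (OE n)].
Qed.

Let om : {outer_measure set (stype X B) -> \bar R} :=
  HB.pack outer (isOuterMeasure.Build R (stype X B) outer
    outer0 outer_ge0 outer_mono outer_sigma_subadditive).

(** E is enlarged to an open G and the open set [G & O] is exhausted by cylinders of formulas phi.
    Since a cylinder is clopen, [G \ cyl B phi] is an open set containing the part of E outside O,
    and [inner_setD] applies to it. *)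
Let open_caratheodory O : open O -> om.-caratheodory O.
Proof.
move=> oO; apply: le_caratheodory_measurable => E.
apply: outer_glb => G oG EG.
apply: (@le_trans _ _ (inner (G `&` O) + outer (E `&` ~` O))).
  apply: leeD => //; apply: outer_ub; first exact: openI.
  by move=> p [/EG].
rewrite -leeBrDr//; apply: inner_lub => phi Bphi sub.
rewrite leeBrDr// addeC.
apply: le_trans (inner_setD Bphi (O := G) _); last by move=> p /sub[].
apply: leeD => //; apply: outer_ub; last by move=> p [/EG Gp nO]; split=> // /sub[].
by rewrite setDE; apply: openI => //; apply: closed_openC; exact: closed_cyl.
Qed.

Let borel_caratheodory (W : set (borel_stype X B)) :
  measurable W -> om.-cara.-measurable W.
Proof.
apply: smallest_sub; last by move=> O; exact: open_caratheodory.
split => //; [by move=> V mV; rewrite setTD; exact: measurableC |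
              by move=> V mV; exact: bigcupT_measurable].
Qed.

Let borel_sigma_additive :
  semi_sigma_additive (outer : set (borel_stype X B) -> \bar R).
Proof.
move=> F mF tF mUF.
apply: (caratheodory_measure_sigma_additive (mu := om)) => //.
  by move=> i; exact: (borel_caratheodory (mF i)).
exact: borel_caratheodory.
Qed.

Let outerT : outer setT = 1.
Proof. by rewrite -cylT outer_cyl ?keislerT//; exact: defined_over_top. Qed.

Let borel_content : {measure set (borel_stype X B) -> \bar R} :=
  HB.pack (outer : set (borel_stype X B) -> \bar R)
   (@isMeasure.Build _ _ _ (outer : set (borel_stype X B) -> \bar R)
      outer0 outer_ge0 borel_sigma_additive).

Let borel_outer : probability (borel_stype X B) R :=
  HB.pack (outer : set (borel_stype X B) -> \bar R)
   (@isMeasure.Build _ _ _ (outer : set (borel_stype X B) -> \bar R)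
      outer0 outer_ge0 borel_sigma_additive)
   (Measure_isProbability.Build _ _ _ borel_content outerT).

Lemma borel_measure_exists : exists m : probability (borel_stype X B) R,
  regular_measure m /\ forall phi, defined_over B phi -> m (cyl B phi) = (mu phi)%:E.
Proof.
exists borel_outer; split=> [W mW e e0|]; last exact: outer_cyl.
(* Two outer approximations within e / 3 leave a gap of at most 2e / 3, which gives the strict
   inequality; the closed set is the complement of G'. *)
have e30 : (0 < e / 3)%R by rewrite divr_gt0.
have [G [oG WG Gle]] := outer_approx W e30.
have [G' [oG' WG' G'le]] := outer_approx (~` W) e30.
have mG : measurable (G : set (borel_stype X B)) by exact: sub_sigma_algebra.
have mG' : measurable (G' : set (borel_stype X B)) by exact: sub_sigma_algebra.
exists (~` G'), G; split=> //.
- exact: open_closedC.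
- by move=> p nG'; apply: contrapT => /WG'.
apply: (@le_lt_trans _ _ (e / 3 + e / 3)%:E); last by rewrite lte_fin; lra.
apply: (probability_sandwich (m := borel_outer) mW) => //=;
  by rewrite outer_open.
Qed.

Lemma borel_measureP : regular_measure (borel_measure B mu) /\
  forall phi, defined_over B phi -> borel_measure B mu (cyl B phi) = (mu phi)%:E.
Proof.
have [m mP] := borel_measure_exists; rewrite /borel_measure.
by case: xgetP => [m' _|/(_ m)//].
Qed.

End KeislerTheory.

(** * Transfer of regular measures along continuous maps of Stone spaces *)

Section Transfer.
Variables (R : realType) (L : language) (U : structure L).
Implicit Types (X Y V : finType) (B C : set U).

Lemma open_borel X B (O : set (stype X B)) :
  open O -> measurable (O : set (borel_stype X B)).
Proof. exact: sub_sigma_algebra. Qed.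

Lemma continuous_borel X V B C (f : stype X B -> stype V C) :
  continuous f -> measurable_fun [set: borel_stype X B] (f : _ -> borel_stype V C).
Proof.
move=> /continuousP fcont.
apply: (@measurability _ _ (borel_stype X B) (borel_stype V C) _ _ open) => //.
by move=> _ [G oG <-]; rewrite setTI; apply: open_borel; exact: fcont.
Qed.

(** The open sets form a generating pi-system that contains the whole space. *)
Lemma borel_measure_eq_open X B (m1 m2 : {measure set (borel_stype X B) -> \bar R}) :
  (m1 setT < +oo)%E -> (forall O, open O -> m1 O = m2 O) ->
  forall W, measurable W -> m1 W = m2 W.
Proof.
move=> m1oo m12 W mW.
apply: (@measure_unique _ _ (borel_stype X B) open (fun=> setT)) => //.
- by move=> O O'; exact: openI.
- by move=> _; exact: openT.
- by rewrite bigcup_const.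
Qed.

Lemma le_borel X B (m : {measure set (borel_stype X B) -> \bar R})
    (W W' : set (borel_stype X B)) :
  measurable W -> measurable W' -> W `<=` W' -> (m W <= m W')%E.
Proof. by move=> mW mW' WW'; apply: le_measure => //; exact/mem_set. Qed.

(** The estimate is given for every Borel S above C because C will be enlarged to a cylinder: O is
    contained in the union of S and [G \ C], and the latter has measure below e. *)
Lemma regular_inner_approx X B (m : probability (borel_stype X B) R)
    (O : set (stype X B)) (e : R) :
  regular_measure m -> open O -> 0 < e ->
  exists C : set (stype X B), [/\ compact C, C `<=` O &
    forall S : set (stype X B), measurable (S : set (borel_stype X B)) ->
      C `<=` S -> (m O <= m S + e%:E)%E].
Proof.
move=> mreg oO e0; have [C [G [Ccl oG CO OG lt]]] := mreg O (open_borel oO) e e0.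
exists C; split=> //; first exact: closed_compact.
move=> S mS CS; have mC : measurable (C : set (borel_stype X B)).
  by rewrite -(setCK C); apply: measurableC; apply: open_borel; exact: closed_openC.
have mD : measurable (G `\` C : set (borel_stype X B)).
  by apply: measurableD => //; exact: open_borel.
apply: (@le_trans _ _ (m (S `|` G `\` C))).
  apply: le_borel; [exact: open_borel|exact: measurableU|].
  by move=> p /OG Gp; have [/CS|] := EM (C p); [left|right].
apply: le_trans (measureU2 _ _ _) _ => //.
by rewrite leeD2l// ltW.
Qed.

(** It is enough to compare the measures on an open O. Each is approximated from inside by a compact
    set, which is then enlarged to a cylinder inside O, or to the preimage of one, where the two
    measures agree. *)
Lemma regular_transfer X V B C (f : stype X B -> stype V C)
    (m : probability (borel_stype X B) R) (m' : probability (borel_stype V C) R) :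
  continuous f -> regular_measure m -> regular_measure m' ->
  (forall phi, defined_over C phi -> m (f @^-1` cyl C phi) = m' (cyl C phi)) ->
  forall W, measurable (W : set (borel_stype V C)) -> m (f @^-1` W) = m' W.
Proof.
move=> fcont mreg m'reg mcyl.
have mf := continuous_borel fcont.
have mpre (O : set (stype V C)) :
    open O -> measurable (f @^-1` O : set (borel_stype X B)).
  by move=> oO; apply: open_borel; move/continuousP : fcont; exact.
pose fm : {measure set (borel_stype V C) -> \bar R} :=
  @giry_map _ _ (borel_stype X B) (borel_stype V C) R f mf m.
apply: (borel_measure_eq_open (m1 := fm)); rewrite /fm/=.
  by rewrite /pushforward/= preimage_setT probability_setT ltry.
move=> O oO; rewrite /pushforward/=; apply/eqP; rewrite eq_le; apply/andP; split.
  apply/lee_addgt0Pr => e e0.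
  have ofO : open (f @^-1` O) by move/continuousP : fcont; exact.
  have [D [Dc DO Dle]] := regular_inner_approx mreg ofO e0.
  (* The formula is interpolated in the target space, between the compact image of D and O, so that
     the preimage of its cylinder contains D. *)
  have fDc : compact (f @` D).
    by apply: continuous_compact => //; exact: continuous_subspaceT.
  have [|phi [Cphi fDphi phiO]] := clopen_interpolation fDc oO.
    by move=> _ [p Dp <-]; exact: DO.
  have /Dle : measurable (f @^-1` cyl C phi : set (borel_stype X B)).
    by apply: mpre; exact: open_cyl.
  move=> Dlephi; apply: le_trans (Dlephi _) _.
    by move=> p Dp; apply: fDphi; exists p.
  rewrite leeD2r// mcyl//; apply: le_borel => //.
    by apply: open_borel; exact: open_cyl.
  exact: open_borel.
apply/lee_addgt0Pr => e e0.
have [D [Dc DO Dle]] := regular_inner_approx m'reg oO e0.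
have [phi [Cphi Dphi phiO]] := clopen_interpolation Dc oO DO.
apply: le_trans (Dle _ (open_borel (open_cyl Cphi)) Dphi) _.
rewrite leeD2r// -mcyl//; apply: le_borel.
- by apply: mpre; exact: open_cyl.
- exact: mpre.
- exact: preimage_subset.
Qed.

Lemma keisler_subset X B C (mu : formula L (X + U) -> R) :
  C `<=` B -> keisler B mu -> keisler C mu.
Proof.
move=> CB [k1 k2 k3 k4]; split=> // [phi|phi psi|phi psi].
- by move=> /(defined_overS CB)/k1.
- by move=> /(defined_overS CB) ? /(defined_overS CB) ?; exact: k3.
- by move=> /(defined_overS CB) ? /(defined_overS CB) ?; exact: k4.
Qed.

Lemma keisler_subst X V (s : V -> X + U) C B (mu : formula L (X + U) -> R) :
  C `<=` B -> subst_over s B -> keisler B mu -> keisler C (mu \o subst s).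
Proof.
move=> CB sB [k1 k2 k3 k4].
have sub phi : defined_over C phi -> defined_over B (subst s phi).
  exact: subst_defined_over.
split=> // [phi /sub/k1//|phi psi /sub Cphi /sub Cpsi eqv|
            phi psi /sub Cphi /sub Cpsi disj].
- by apply: k3 => // a; rewrite !satU_subst.
- by apply: (k4 (subst s phi)) => // a; rewrite !satU_subst.
Qed.

Lemma borel_measure_subst X V (s : V -> X + U) C B (mu : formula L (X + U) -> R)
    (CB : C `<=` B) (sB : subst_over s B) : keisler B mu ->
  forall W, measurable (W : set (borel_stype V C)) ->
  borel_measure B mu (subst_type CB sB @^-1` W) = borel_measure C (mu \o subst s) W.
Proof.
move=> kmu; have ks := keisler_subst CB sB kmu.
have [mreg mcyl] := borel_measureP kmu; have [m'reg m'cyl] := borel_measureP ks.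
apply: regular_transfer => //; first exact: continuous_subst_type.
move=> phi Cphi; rewrite preimage_cyl// m'cyl// mcyl//.
exact: subst_defined_over Cphi.
Qed.

(** Transfer along the identity map gives uniqueness of the regular extension. *)
Lemma borel_measure_eq X B (mu mu' : formula L (X + U) -> R) :
  keisler B mu -> keisler B mu' ->
  (forall phi, defined_over B phi -> mu phi = mu' phi) ->
  forall W, measurable (W : set (borel_stype X B)) ->
  borel_measure B mu W = borel_measure B mu' W.
Proof.
move=> kmu kmu' mumu'.
have [mreg mcyl] := borel_measureP kmu; have [m'reg m'cyl] := borel_measureP kmu'.
move=> W mW; rewrite -[W in LHS]preimage_id.
apply: regular_transfer => //; first by move=> p.
by move=> phi Bphi; rewrite preimage_id mcyl// m'cyl// mumu'.
Qed.

Lemma integral_borel_subst X V (s : V -> X + U) C B (mu : formula L (X + U) -> R)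
    (CB : C `<=` B) (sB : subst_over s B) (f : borel_stype V C -> R) :
  keisler B mu -> measurable_fun setT f -> (forall q, 0 <= f q) ->
  \int[borel_measure B mu]_p f (subst_type CB sB p) =
  \int[borel_measure C (mu \o subst s)]_q f q.
Proof.
move=> kmu mf f0; congr fine.
have ms : measurable_fun [set: borel_stype X B]
    (subst_type CB sB : _ -> borel_stype V C).
  exact: continuous_borel (@continuous_subst_type _ _ _ _ _ _ _ CB sB).
transitivity (giry_int (giry_map ms (borel_measure B mu)) (EFin \o f)).
  by rewrite giry_int_map//; exact/measurable_EFinP.
by apply: eq_measure_integral => W mW _; exact: borel_measure_subst.
Qed.

Lemma eq_integral_borel X B (mu mu' : formula L (X + U) -> R)
    (f : borel_stype X B -> R) :
  keisler B mu -> keisler B mu' ->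
  (forall phi, defined_over B phi -> mu phi = mu' phi) ->
  \int[borel_measure B mu]_q f q = \int[borel_measure B mu']_q f q.
Proof.
move=> kmu kmu' mumu'; congr fine.
by apply: eq_measure_integral => W mW _; exact: borel_measure_eq.
Qed.

End Transfer.

(** * Morley products *)

Section FormulaFunction.
Variables (R : realType) (L : language) (K : Type) (U : structure L).
Hypothesis Usat : saturated K U.
Implicit Types (X Y Z : finType) (A B : set U).

Lemma inst_subst_param X Y Z (phi : formula L ((X + (Y + Z)) + U))
    (b : Y -> U) (c : Z -> U) :
  inst (subst (subst_param c) phi) b = inst phi (pair_tuple b c).
Proof.
rewrite !inst_subst subst_subst; congr subst.
by apply/funext => -[|[]].
Qed.

Lemma inst_assoc X Y Z (phi : formula L (((X + Y) + Z) + U)) (c : Z -> U) :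
  inst phi c = subst (subst_param c) (assoc_formula phi).
Proof.
rewrite /inst /subst /assoc_formula formula_map_comp; congr formula_map.
by apply/funext => -[[[]|]|].
Qed.

Lemma assoc_defined_over X Y Z A (phi : formula L (((X + Y) + Z) + U)) :
  defined_over A phi -> defined_over A (assoc_formula phi).
Proof.
move=> Aphi u; rewrite /params /assoc_formula/= fv_map => -[[[[i|j]|k]|w]] //.
by move=> wphi [<-]; exact: Aphi.
Qed.

Lemma equiv_over_pair Y Z A (b b' : Y -> U) (c : Z -> U) : range c `<=` A ->
  equiv_over A b b' -> equiv_over A (pair_tuple b c) (pair_tuple b' c).
Proof.
move=> cA bb' phi Aphi; rewrite -!satU_inst; apply: bb'.
exact: inst_defined_over.
Qed.

Lemma equiv_overS Y A B (b b' : Y -> U) :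
  A `<=` B -> equiv_over B b b' -> equiv_over A b b'.
Proof. by move=> AB bb' phi Aphi; apply: bb'; exact: defined_overS Aphi. Qed.

Lemma invariant_overS X A B (mu : formula L (X + U) -> R) :
  A `<=` B -> invariant_over A mu -> invariant_over B mu.
Proof.
by move=> AB muA Y phi phi0 b b' bb'; apply: muA => //; exact: equiv_overS bb'.
Qed.

(** The definition of invariance concerns parameter-free formulas; parameters in A are moved into a
    tuple c, and bc, b'c still have the same type over A. *)
Lemma invariant_over_inst X Y A (mu : formula L (X + U) -> R)
    (phi : formula L ((X + Y) + U)) (b b' : Y -> U) :
  invariant_over A mu -> defined_over A phi -> equiv_over A b b' ->
  mu (inst phi b) = mu (inst phi b').
Proof.
move=> muA Aphi bb'; have [Z [c [psi [psi0 cphi ->]]]] := extract_params phi.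
rewrite !inst_subst_param; apply: muA => //.
by apply: equiv_over_pair => //; exact: subset_trans Aphi.
Qed.

Lemma FfmlE X Y B (mu : formula L (X + U) -> R) (phi : formula L ((X + Y) + U))
    (q : stype Y B) (b : Y -> U) :
  invariant_over B mu -> defined_over B phi -> realizes b q ->
  Ffml mu phi q = mu (inst phi b).
Proof.
move=> muB Bphi bq; apply: xget_subset1; first by exists b.
move=> _ _ [b1 b1q ->] [b2 b2q ->]; apply: invariant_over_inst muB Bphi _.
exact: realizes_equiv b1q b2q.
Qed.

Lemma Ffml_ge0 X Y B (mu : formula L (X + U) -> R)
    (phi : formula L ((X + Y) + U)) (q : borel_stype Y B) :
  keisler setT mu -> 0 <= Ffml mu phi q.
Proof.
move=> kmu; rewrite /Ffml; case: xgetP => // _ _ [b _ ->].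
exact: (keisler_ge0 kmu).
Qed.

Lemma Ffml_le1 X Y B (mu : formula L (X + U) -> R)
    (phi : formula L ((X + Y) + U)) (q : borel_stype Y B) :
  keisler setT mu -> Ffml mu phi q <= 1.
Proof.
move=> kmu; rewrite /Ffml; case: xgetP => // _ _ [b _ ->].
exact: (keisler_le1 kmu).
Qed.

(** Saturation gives b realizing q; then bc realizes the image of q, and both sides are mu(phi(x, b,
    c)). *)
Lemma Ffml_subst X Y Z A B (mu : formula L (X + U) -> R)
    (phi : formula L ((X + (Y + Z)) + U)) (c : Z -> U)
    (AB : A `<=` B) (cB : subst_over (@subst_inst L U Y Z c) B) q :
  small K B -> invariant_over A mu -> defined_over A phi ->
  defined_over B (subst (subst_param c) phi) ->
  Ffml mu (subst (subst_param c) phi) q = Ffml mu phi (subst_type AB cB q).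
Proof.
move=> Bsmall muA Aphi Bphi; have [b bq] := Usat Bsmall q.
rewrite (FfmlE (invariant_overS AB muA) Bphi bq).
rewrite (FfmlE muA Aphi (realizes_subst_type bq)).
by rewrite subst_tuple_inst inst_subst_param.
Qed.

(** Borel definability is about parameter-free formulas over A. Writing phi = psi(x, y, c) with c in
    B, the function of phi over B is that of psi over A composed with the continuous map q(y) |->
    q(y) c. *)
Lemma measurable_Ffml X Y A B (mu : formula L (X + U) -> R)
    (phi : formula L ((X + Y) + U)) :
  A `<=` B -> small K B -> borel_definable A mu -> defined_over B phi ->
  measurable_fun [set: borel_stype Y B] (Ffml mu phi).
Proof.
move=> AB Bsmall [kmu muA muF] Bphi.
have [Z [c [psi [psi0 cphi phiE]]]] := extract_params phi.
have cB : subst_over (@subst_inst L U Y Z c) B.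
  by apply: subst_inst_over; exact: subset_trans Bphi.
have -> : Ffml mu phi = Ffml mu psi \o (subst_type AB cB : borel_stype Y B -> _).
  apply/funext => q; rewrite phiE /= -Ffml_subst//.
    exact: defined_overS psi0.
  by rewrite -phiE.
apply: measurableT_comp; first exact: muF.
exact: continuous_borel (@continuous_subst_type _ _ _ _ _ _ _ AB cB).
Qed.

End FormulaFunction.

(** * The Morley product as an invariant Keisler measure *)

Section MorleyProduct.
Variables (R : realType) (L : language) (K : Type) (U : structure L).
Hypotheses (natK : ([set: nat] #<= [set: K])%card) (Usat : saturated K U).
Variables (A : set U) (X Y : finType).
Variables (mu : formula L (X + U) -> R) (nu : formula L (Y + U) -> R).
Hypotheses (Asmall : small K A) (muA : borel_definable A mu).
Hypothesis knu : keisler setT nu.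

(** The measure nu_c: the image of nu under b |-> bc, concentrated on z = c. *)
Definition keisler_fiber (Z : finType) (c : Z -> U) (phi : formula L ((Y + Z) + U)) :=
  nu (inst phi c).

Lemma keisler_fiberE (Z : finType) (c : Z -> U) :
  keisler_fiber c = nu \o subst (subst_inst c).
Proof. by apply/funext => phi; rewrite /keisler_fiber inst_subst. Qed.

Lemma keisler_keisler_fiber (Z : finType) (c : Z -> U) (B : set U) :
  keisler B (keisler_fiber c).
Proof. by rewrite keisler_fiberE; apply: keisler_subst knu. Qed.

Let kmu : keisler setT mu. Proof. by case: muA. Qed.
Let mu_inv : invariant_over A mu. Proof. by case: muA. Qed.

(** Change of variables along q(y) |-> q(y) c. The right-hand side does not mention B, whence the
    independence of the Morley product from B. *)
Lemma integral_Ffml_fiber (Z : finType) (c : Z -> U) (B : set U)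
    (phi : formula L ((X + (Y + Z)) + U)) :
  A `<=` B -> small K B -> range c `<=` B -> defined_over A phi ->
  \int[borel_measure B nu]_q Ffml mu (subst (subst_param c) phi) q =
  \int[borel_measure A (keisler_fiber c)]_q Ffml mu phi q.
Proof.
move=> AB Bsmall cB Aphi.
have cB' : subst_over (@subst_inst L U Y Z c) B by exact: subst_inst_over.
rewrite keisler_fiberE -(integral_borel_subst AB cB'); last first.
- by move=> q; exact: Ffml_ge0.
- exact: measurable_Ffml Asmall muA Aphi.
- exact: keisler_subset knu.
apply: eq_Rintegral => q _; apply: (Ffml_subst Usat) => //.
apply: subst_defined_over Aphi => //; exact: subst_param_over.
Qed.

Lemma small_setU_params (V : Type) (phi : formula L (V + U)) :
  small K (A `|` params phi).
Proof. exact/small_setU_finite/finite_params. Qed.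

Lemma morleyE (B : set U) (phi : formula L ((X + Y) + U)) :
  A `<=` B -> small K B -> defined_over B phi ->
  morley A mu nu phi = \int[borel_measure B nu]_q Ffml mu phi q.
Proof.
move=> AB Bsmall Bphi; rewrite /morley.
have [Z [c [psi [psi0 cphi phiE]]]] := extract_params phi; subst phi.
have Apsi : defined_over A psi by exact: defined_overS psi0.
rewrite !integral_Ffml_fiber//.
- exact: subset_trans Bphi.
- exact: small_setU_params.
- by apply: subset_trans (@subsetUr _ _ _) => u /cphi.
Qed.

Lemma morley_inst (Z : finType) (c : Z -> U) (phi : formula L (((X + Y) + Z) + U)) :
  defined_over A phi ->
  morley A mu nu (inst phi c) =
  \int[borel_measure A (keisler_fiber c)]_q Ffml mu (assoc_formula phi) q.
Proof.
move=> Aphi; pose B := A `|` range c.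
have Bsmall : small K B by apply: small_setU_finite => //; exact: finite_image.
have AB : A `<=` B by exact: subsetUl.
have cB : range c `<=` B by exact: subsetUr.
rewrite (@morleyE B)//.
  rewrite inst_assoc integral_Ffml_fiber//; exact: assoc_defined_over.
apply: inst_defined_over => //; exact: defined_overS Aphi.
Qed.

(** At each type q, realized by some b, the axioms for mu hold for the formulas instantiated at b;
    integrating over q gives those for the product. *)
Lemma keisler_morley : keisler setT (morley A mu nu).
Proof.
have intF B (phi : formula L ((X + Y) + U)) : A `<=` B -> small K B ->
    defined_over B phi ->
    (borel_measure B nu).-integrable setT (EFin \o Ffml mu phi).
  move=> AB Bsmall Bphi; apply: measurable_bounded_integrable => //.
  - by rewrite ltey_eq fin_num_measure.
  - exact: measurable_Ffml AB Bsmall muA Bphi.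
  - exists 1; split=> // x x1 q _ /=; rewrite ger0_norm; last exact: Ffml_ge0.
    by apply: le_trans (ltW x1); exact: Ffml_le1.
split.
- by move=> phi _; apply: Rintegral_ge0 => q _; exact: Ffml_ge0.
- rewrite (@morleyE A)//; last exact: defined_over_top.
  transitivity (\int[borel_measure A nu]_(q in setT) 1).
    apply: eq_Rintegral => q _; have [b bq] := Usat Asmall q.
    have topA := @defined_over_top L U (X + Y)%type A.
    by rewrite (FfmlE mu_inv topA bq); exact: (keislerT kmu).
  by rewrite Rintegral_cst// mul1r; exact: (congr1 fine (probability_setT _)).
- move=> phi psi _ _ eqv.
  (* One small B serves both formulas, so that [morleyE] writes both values as integrals over the
     same space of types. *)
  pose B := A `|` (params phi `|` params psi).
  have AB : A `<=` B by exact: subsetUl.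
  have Bsmall : small K B.
    by apply: small_setU_finite => //; rewrite finite_setU; split; exact: finite_params.
  have Bphi : defined_over B phi by move=> u; right; left.
  have Bpsi : defined_over B psi by move=> u; right; right.
  rewrite !(@morleyE B)//; apply: eq_Rintegral => q _.
  have [b bq] := Usat Bsmall q; have muB := invariant_overS AB mu_inv.
  rewrite (FfmlE muB Bphi bq) (FfmlE muB Bpsi bq).
  by apply: (keisler_eq kmu) => // a; rewrite !satU_inst.
- move=> phi psi _ _ disj.
  pose B := A `|` (params phi `|` params psi).
  have AB : A `<=` B by exact: subsetUl.
  have Bsmall : small K B.
    by apply: small_setU_finite => //; rewrite finite_setU; split; exact: finite_params.
  have Bphi : defined_over B phi by move=> u; right; left.
  have Bpsi : defined_over B psi by move=> u; right; right.
  have Bor : defined_over B (FOr phi psi) by rewrite defined_over_or.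
  rewrite !(@morleyE B)// -RintegralD//; [|exact: intF|exact: intF].
  apply: eq_Rintegral => q _.
  have [b bq] := Usat Bsmall q; have muB := invariant_overS AB mu_inv.
  rewrite (FfmlE muB Bor bq) (FfmlE muB Bphi bq) (FfmlE muB Bpsi bq).
  by apply: (keislerU kmu) => // a; rewrite !satU_inst.
Qed.

Lemma keisler_fiber_eq (Z : finType) (c c' : Z -> U) (W : set (borel_stype (Y + Z) A)) :
  invariant_over A nu -> equiv_over A c c' -> measurable W ->
  borel_measure A (keisler_fiber c) W = borel_measure A (keisler_fiber c') W.
Proof.
move=> nuA cc' mW; apply: borel_measure_eq => //; try exact: keisler_keisler_fiber.
by move=> phi Aphi; exact: (invariant_over_inst nuA Aphi cc').
Qed.

(** By [morley_inst], the value at an instance phi(x, y, c) depends on c only through nu_c on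
    formulas over A, hence only on tp(c/A). *)
Lemma invariant_morley : invariant_over A nu -> invariant_over A (morley A mu nu).
Proof.
move=> nuA Z phi phi0 b b' bb'.
have Aphi : defined_over A phi by exact: defined_overS phi0.
rewrite !morley_inst//; apply: eq_integral_borel; try exact: keisler_keisler_fiber.
by move=> psi Apsi; exact: (invariant_over_inst nuA Apsi bb').
Qed.

(** The fiber of W at b is the preimage of W under the continuous map p |-> p b, so its measure is
    nu_b(W), which depends only on tp(b/A). *)
Lemma FsetE (Z : finType) (q : stype Z A) (c : Z -> U)
    (W : set (borel_stype (Y + Z) A)) :
  invariant_over A nu -> realizes c q -> measurable W ->
  Fset nu W q = borel_measure A (keisler_fiber c) W.
Proof.
move=> nuA cq mW.
have fiberE (b : Z -> U) :
    borel_measure setT nu (fiber W b) = borel_measure A (keisler_fiber b) W.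
  have AT : A `<=` setT by [].
  have bT : subst_over (@subst_inst L U Y Z b) setT by [].
  rewrite keisler_fiberE -(borel_measure_subst AT bT)//; congr (borel_measure _ _ _).
  have Bsmall : small K (A `|` range b).
    by apply: small_setU_finite => //; exact: finite_image.
  (* All realizations a of p over Ab give the same type of ab over A, namely the image of p;
     saturation provides one. *)
  have tpE p a : realizes a (restr p (A `|` range b)) ->
      tp (pair_tuple a b) A = subst_type AT bT p.
    move=> ap; apply: realizes_uniq; first exact: realizes_tp.
    move=> phi [Aphi pphi]; rewrite -satU_inst; apply: ap; split.
      apply: inst_defined_over => //; exact: defined_overS Aphi.
    by rewrite inst_subst.
  apply/seteqP; split=> p /=; first by move=> [a /tpE <-].
  have [a ap] := Usat Bsmall (restr p (A `|` range b)).
  by rewrite -(tpE p a)//; exists a.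
apply: xget_subset1; first by exists c; rewrite ?fiberE.
move=> _ _ [b1 b1q ->] [b2 b2q ->]; rewrite !fiberE.
by apply: keisler_fiber_eq => //; exact: realizes_equiv b1q b2q.
Qed.

End MorleyProduct.

(** * The probability kernel tp(c/A) |-> nu_c and associativity *)

Section FiberKernel.
Variables (R : realType) (L : language) (K : Type) (U : structure L).
Hypotheses (natK : ([set: nat] #<= [set: K])%card) (Usat : saturated K U).
Variables (A : set U) (Y Z : finType) (nu : formula L (Y + U) -> R).
Hypotheses (Asmall : small K A) (nuBD : BDplus A nu).

Let knu : keisler setT nu. Proof. by case: nuBD. Qed.
Let nu_inv : invariant_over A nu. Proof. by case: nuBD. Qed.

Definition realization (q : borel_stype Z A) : Z -> U :=
  projT1 (cid (Usat Asmall (q : stype Z A))).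

Lemma realizationP q : realizes (realization q) (q : stype Z A).
Proof. by rewrite /realization; case: cid. Qed.

Definition fiber_kernel (q : borel_stype Z A) : giry (borel_stype (Y + Z) A) R :=
  borel_measure A (keisler_fiber nu (realization q)).

Lemma fiber_kernelE q (W : set (borel_stype (Y + Z) A)) : measurable W ->
  fiber_kernel q W = Fset nu W q.
Proof.
move=> mW; rewrite (FsetE natK Usat Asmall knu nu_inv (@realizationP q) mW).
by [].
Qed.

(** BD+ settles the open sets, a pi-system; the sets W with measurable evaluation are closed under
    complements and countable disjoint unions. *)
Lemma measurable_fiber_kernel_ev (W : set (borel_stype (Y + Z) A)) : measurable W ->
  measurable_fun [set: borel_stype Z A] (fiber_kernel ^~ W).
Proof.
move: W; apply: (dynkin_induction (T := borel_stype (Y + Z) A) (G := open)) => //.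
- by move=> O O'; exact: openI.
- rewrite [X in measurable_fun _ X](_ : _ = cst 1%E); first exact: measurable_cst.
  by apply/funext => q; exact: probability_setT.
- move=> O oO; rewrite [X in measurable_fun _ X](_ : _ = Fset nu O).
    by case: nuBD => _ _; exact.
  by apply/funext => q; rewrite fiber_kernelE//; exact: open_borel.
- move=> W mW mkW.
  rewrite [X in measurable_fun _ X](_ : _ = fun q => (1 - fiber_kernel q W)%E).
    exact: emeasurable_funB.
  by apply/funext => q; exact: probability_setC.
- move=> F mF tF mkF.
  rewrite [X in measurable_fun _ X](_ : _ =
      fun q => (\sum_(n <oo) fiber_kernel q (F n))%E).
    exact: ge0_emeasurable_sum.
  apply/funext => q; apply/esym/cvg_lim => //; exact: measure_sigma_additive.
Qed.

Lemma measurable_fiber_kernel : measurable_fun setT fiber_kernel.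
Proof.
apply: measurable_giry_codensity => // W; exact: measurable_fiber_kernel_ev.
Qed.

Variables (X : finType) (mu : formula L (X + U) -> R).
Hypothesis muA : borel_definable A mu.

Let kmu : keisler setT mu. Proof. by case: muA. Qed.

Lemma Ffml_morley (phi : formula L (((X + Y) + Z) + U)) q : defined_over A phi ->
  (Ffml (morley A mu nu) phi q)%:E =
  giry_int (fiber_kernel q) (EFin \o Ffml mu (assoc_formula phi)).
Proof.
move=> Aphi.
have minv := invariant_morley natK Usat Asmall muA knu nu_inv.
rewrite (FfmlE minv Aphi (@realizationP q)).
rewrite (morley_inst natK Usat Asmall muA knu)// /Rintegral fineK//.
have mF : measurable_fun [set: borel_stype (Y + Z) A] (Ffml mu (assoc_formula phi)).
  apply: (measurable_Ffml Usat _ Asmall muA) => //; exact: assoc_defined_over.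
(* The integral is finite, being at most 1, so taking [fine] of it loses nothing. *)
rewrite ge0_fin_numE; last first.
  by apply: integral_ge0 => p _; rewrite lee_fin; exact: Ffml_ge0.
apply: (@le_lt_trans _ _ 1%E); last exact: ltry.
apply: (@le_trans _ _ (\int[fiber_kernel q]_p (cst 1 p))%E); last first.
  by rewrite integral_cst// mul1e; exact: sprobability_setT.
apply: ge0_le_integral => //.
- by move=> p _; rewrite lee_fin; exact: Ffml_ge0.
- exact/measurable_EFinP.
- by move=> p _; rewrite lee_fin; exact: Ffml_le1.
Qed.

Lemma measurable_Ffml_morley (phi : formula L (((X + Y) + Z) + U)) :
  defined_over A phi ->
  measurable_fun [set: borel_stype Z A] (Ffml (morley A mu nu) phi).
Proof.
move=> Aphi; apply/measurable_EFinP.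
(* Integration of a fixed nonnegative Borel function is measurable in the measure, and it is
   composed with the measurable kernel. *)
rewrite [X in measurable_fun _ X](_ : _ =
    (fun m => giry_int m (EFin \o Ffml mu (assoc_formula phi))) \o fiber_kernel).
  apply: measurableT_comp; last exact: measurable_fiber_kernel.
  apply: measurable_giry_int; last by move=> p; rewrite lee_fin; exact: Ffml_ge0.
  apply/measurable_EFinP.
  apply: (measurable_Ffml Usat _ Asmall muA) => //; exact: assoc_defined_over.
by apply/funext => q; exact: Ffml_morley.
Qed.

Lemma integral_Ffml_morley (lambda : formula L (Z + U) -> R)
    (phi : formula L (((X + Y) + Z) + U)) : BDplusplus A nu ->
  keisler setT lambda -> defined_over A phi ->
  \int[borel_measure A lambda]_q Ffml (morley A mu nu) phi q =
  \int[borel_measure A (morley A nu lambda)]_p Ffml mu (assoc_formula phi) p.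
Proof.
move=> [_ nuBD2] klambda Aphi; congr fine.
have mF : measurable_fun [set: borel_stype (Y + Z) A]
    (EFin \o Ffml mu (assoc_formula phi)).
  apply/measurable_EFinP.
  apply: (measurable_Ffml Usat _ Asmall muA) => //; exact: assoc_defined_over.
have F0 p : (0 <= (EFin \o Ffml mu (assoc_formula phi)) p)%E.
  by rewrite lee_fin; exact: Ffml_ge0.
transitivity (giry_int (borel_measure A lambda)
    (fun q => giry_int (fiber_kernel q) (EFin \o Ffml mu (assoc_formula phi)))).
  by apply: eq_integral => q _; exact: Ffml_morley.
(* The iterated integral is an integral against the mixture of the kernel by lambda; it remains to
   identify this mixture with the measure of nu * lambda, which BD++ does on open sets. *)
rewrite -(giry_int_bind _ measurable_fiber_kernel)//.
apply: eq_measure_integral => W mW _; apply/esym.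
move: W mW; apply: borel_measure_eq_open.
  by rewrite ltey_eq fin_num_measure.
move=> O oO; apply: etrans (nuBD2 _ _ oO _ klambda) _.
rewrite /giry_bind/= giry_int_map//; last first.
  by apply: measurable_giry_ev; exact: open_borel.
by apply: eq_integral => q _; rewrite /= -fiber_kernelE//; exact: open_borel.
Qed.

End FiberKernel.

Theorem theorem2p11 (R : realType) (L : language) (T : theory L) (K : Type)
    (U : structure L) (A : set U) (X Y : finType)
    (mu : formula L (X + U) -> R) (nu : formula L (Y + U) -> R) :
  complete_theory T -> monster K U T -> small K A ->
  borel_definable A mu -> keisler setT nu ->
  (BDplus A nu -> borel_definable A (morley A mu nu)) /\
  (BDplusplus A nu ->
   forall (Z : finType) (lambda : formula L (Z + U) -> R), keisler setT lambda ->
     eq_restr_assoc A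
       (morley A (morley A mu nu) lambda)
       (morley A mu (morley A nu lambda))).
Proof.
move=> _ [_ [formK _] Usat _] Asmall muA knu.
have natK := card_le_trans (@card_le_nat_formula L) formK.
split=> [nuBD|nuBD Z lambda klambda phi Aphi].
  split; first exact: (keisler_morley natK Usat Asmall muA knu).
    by apply: (invariant_morley natK Usat Asmall muA knu); case: nuBD.
  move=> Z phi phi0; apply: (measurable_Ffml_morley natK Usat Asmall nuBD muA).
  exact: defined_overS phi0.
(* As phi is over A, both outer products are integrals over types over A itself. *)
rewrite /morley !setUidl//; last exact: assoc_defined_over.
by apply: (integral_Ffml_morley natK Usat Asmall _ muA nuBD) => //; case: nuBD.
Qed.
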